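(* Let $n\ge 1$ be an integer, $N=2n+1$, and let $H_N\mathbb{R}$ be the classical Heisenberg group with the coordinates $(x^1,\dots,x^N)$ and left-invariant coframe $\{\theta^1,\dots,\theta^N\}$ described in the context. Let $g(t)=\sum_{I=1}^N g_I(t)\,\theta^I\otimes\theta^I$, $t\in[0,\infty)$, be any solution to Ricci flow on $H_N\mathbb{R}$ with diagonal left-invariant initial data. For $s>0$ let $\phi_s : H_N\mathbb{R}\to H_N\mathbb{R}$ be the diffeomorphism $$\phi_s(x^1,\dots,x^N) = \big(\alpha^1(s)x^1,\dots,\alpha^N(s)x^N\big),$$ where, for $1\le i\le n$, $$\alpha^i(s) = (n+2)^{-\frac{1}{2(n+2)}}A_i^{-\frac14}\,C^{-\frac{1}{4(n+2)}}\,s^{\frac{n+1}{2(n+2)}},\qquad \alpha^{i+n}(s) = (n+2)^{-\frac{1}{2(n+2)}}B_{i+n}^{-\frac14}\,C^{-\frac{1}{4(n+2)}}\,s^{\frac{n+1}{2(n+2)}},$$ $$\alpha^N(s) = \alpha^i(s)\,\alpha^{i+n}(s) = (n+2)^{-\frac{1}{n+2}}\,C^{-\frac{1}{2(n+2)}}\,s^{\frac{n+1}{n+2}},$$ with $A_i = g_i(0)/g_{i+n}(0)$, $B_{i+n} = g_{i+n}(0)/g_i(0)$ and $C = g_1(0)\cdots g_{2n}(0)\,g_N(0)^2$. Then, for every $t>0$, $$ \lim_{s\to\infty}\frac1s\,\phi_s^* g(st) = t^{\frac{1}{n+2}}\big(\theta^1\otimes\theta^1+\cdots+\theta^{2n}\otimes\theta^{2n}\big)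 + \frac{1}{n+2}\,t^{-\frac{n}{n+2}}\,\theta^N\otimes\theta^N =: g_\infty(t). $$ The metric $g_\infty(1)$ is a nilsoliton with respect to the diffeomorphisms $$ \eta_t(x^1,\dots,x^{2n},x^N) = \Big(t^{-\frac12\frac{n+1}{n+2}}x^1,\dots,t^{-\frac12\frac{n+1}{n+2}}x^{2n},\,t^{-\frac{n+1}{n+2}}x^N\Big),\qquad t>0, $$ i.e. $g_\infty(t) = t\,\eta_t^*g_\infty(1)$ is a solution of Ricci flow.
   Context: The group $H_N\mathbb{R} \subset \mathrm{SL}_{n+2}\mathbb{R}$ consists of the real $(n+2)\times(n+2)$ matrices $\begin{pmatrix} 1 & a^T & c \\ 0 & I_n & b \\ 0 & 0 & 1\end{pmatrix}$ with $a,b\in\mathbb{R}^n$, $c\in\mathbb{R}$, under matrix multiplication. The global coordinates are $(x^1,\dots,x^n) = a$, $(x^{1+n},\dots,x^{2n}) = b$, $x^N = c$. The left-invariant coframe is $$\theta^i = dx^i,\qquad \theta^{i+n} = dx^{i+n} \quad (1\le i\le n), \qquad \theta^N = dx^N - \sum_{k=1}^n x^k\,dx^{k+n}.$$ A left-invariant metric $g = \sum_{I,J} g_{IJ}\,\theta^I\otimes\theta^J$ (constant coefficients) is diagonal if $g_{IJ}=0$ for $I\neq J$; one then writes $g_I = g_{II}$. A Ricci flow solution is a one-parameter family of metrics with $\frac{d}{dt} g = -2\,\mathrm{Rc}(g)$; solutions starting at a left-invariant metric are understood to be left-invariant, and diagonality is preserved by the flow. Limits of left-invariant metrics are limits of their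 coefficients in the coframe. A left-invariant metric $g$ on a nilpotent Lie group is a nilsoliton (with respect to diffeomorphisms $\eta_t$) if $g(t) = c(t)\,\eta_t^* g$ is a solution of Ricci flow for some function $c(t)$ and a one-parameter family of diffeomorphisms $\{\eta_t\}$; it is expanding if $c(t)=t$. *)

(* Defs.v *)
(* Written with MathComp and MathComp-Analysis. *)
From HB Require Import structures.
From mathcomp Require Import all_boot all_order all_algebra.
From mathcomp Require Import all_classical all_reals all_analysis.

Set Implicit Arguments.
Unset Strict Implicit.
Unset Printing Implicit Defensive.

Import Order.TTheory GRing.Theory Num.Theory.
Import numFieldNormedType.Exports.
Local Open Scope classical_set_scope.
Local Open Scope ring_scope.

(* Riemannian geometry on R^m in its global coordinates: a 2-tensor field is
   given by the matrix of its components g_ij with respect to dx^i (x) dx^j,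
   at each point. *)

Definition partial (R : realType) (m : nat) (i : 'I_m)
    (f : 'rV[R]_m -> R) (x : 'rV[R]_m) : R :=
  derive (f : 'rV[R]_m -> R^o) x (delta_mx 0 i).

Fixpoint Ck (R : realType) (m : nat) (k : nat) (f : 'rV[R]_m -> R) : Prop :=
  continuous f /\
  if k is k'.+1 then
    forall i : 'I_m,
      (forall x, derivable (f : 'rV[R]_m -> R^o) x (delta_mx 0 i)) /\
      Ck k' (partial i f)
  else True.

Definition smooth (R : realType) (m : nat) (f : 'rV[R]_m -> R) : Prop :=
  forall k : nat, Ck k f.

Definition smooth_map (R : realType) (m : nat)
    (phi : 'rV[R]_m -> 'rV[R]_m) : Prop :=
  forall k : 'I_m, smooth (fun x => phi x 0 k).

Definition diffeomorphism (R : realType) (m : nat)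
    (phi : 'rV[R]_m -> 'rV[R]_m) : Prop :=
  smooth_map phi /\
  exists psi, [/\ smooth_map psi, cancel phi psi & cancel psi phi].

Definition tensor2 (R : realType) (m : nat) : Type := 'rV[R]_m -> 'M[R]_m.

Definition riemannian_metric (R : realType) (m : nat) (g : tensor2 R m) : Prop :=
  [/\ forall i j, smooth (fun x => g x i j),
      forall x, (g x)^T = g x
    & forall x (v : 'rV[R]_m), v != 0 -> 0 < (v *m g x *m v^T) 0 0].

Definition pullback (R : realType) (m : nat) (phi : 'rV[R]_m -> 'rV[R]_m)
    (g : tensor2 R m) : tensor2 R m := fun x =>
  \matrix_(i, j) \sum_k \sum_l
    partial i (fun y => phi y 0 k) x * partial j (fun y => phi y 0 l) x
    * g (phi x) k l.

(* [christoffel g k i j] is Gamma^k_ij. *)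
Definition christoffel (R : realType) (m : nat) (g : tensor2 R m)
    (k i j : 'I_m) (x : 'rV[R]_m) : R :=
  2^-1 * \sum_l invmx (g x) k l *
    (partial i (fun y => g y j l) x + partial j (fun y => g y i l) x
     - partial l (fun y => g y i j) x).

(* Sign convention: positive on round spheres. *)
Definition ricci (R : realType) (m : nat) (g : tensor2 R m) : tensor2 R m :=
  fun x => \matrix_(i, j)
  (\sum_k (partial k (christoffel g k i j) x - partial j (christoffel g k i k) x)
   + \sum_k \sum_l
      (christoffel g k k l x * christoffel g l i j x
       - christoffel g k j l x * christoffel g l i k x)).

(* The time derivative is taken within the time set [T], hence one-sided at an
   endpoint belonging to [T]. *)
Definition ricci_flow (R : realType) (m : nat) (T : set R)
    (g : R -> tensor2 R m) : Prop :=
  forall t, T t ->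
    riemannian_metric (g t) /\
    forall x i j,
      (s - t)^-1 * (g s x i j - g t x i j) @[s --> within T t^']
        --> - 2 * ricci (g t) x i j.

(* The Heisenberg group of dimension n + n + 1. *)

Definition ia (n : nat) (i : 'I_n) : 'I_(n + n + 1) := lshift 1 (lshift n i).
Definition ib (n : nat) (i : 'I_n) : 'I_(n + n + 1) := lshift 1 (rshift n i).
Definition iN (n : nat) : 'I_(n + n + 1) := rshift (n + n) ord0.

Definition xa (R : realType) (n : nat) (x : 'rV[R]_(n + n + 1)) : 'rV[R]_n :=
  lsubmx (lsubmx x).
Definition xb (R : realType) (n : nat) (x : 'rV[R]_(n + n + 1)) : 'rV[R]_n :=
  rsubmx (lsubmx x).
Definition xc (R : realType) (n : nat) (x : 'rV[R]_(n + n + 1)) : 'M[R]_1 :=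
  rsubmx x.

(* The matrix with coordinates [x]. *)
Definition heis_mx (R : realType) (n : nat) (x : 'rV[R]_(n + n + 1)) :
    'M[R]_(1 + (n + 1)) :=
  block_mx 1%:M (row_mx (xa x) (xc x)) 0 (block_mx 1%:M (xb x)^T 0 1%:M).

(* The group law in coordinates; see [heis_mxM]. *)
Definition heis_mul (R : realType) (n : nat) (x y : 'rV[R]_(n + n + 1)) :
    'rV[R]_(n + n + 1) :=
  row_mx (row_mx (xa x + xa y) (xb x + xb y))
         (xc x + xc y + xa x *m (xb y)^T).

Lemma heis_mx_inj (R : realType) (n : nat) : injective (@heis_mx R n).
Proof.
move=> x y /eq_block_mx[_ /eq_row_mx[ea ec] _ /eq_block_mx[_ /trmx_inj eb _ _]].
rewrite -(hsubmxK x) -(hsubmxK y) -(hsubmxK (lsubmx x)) -(hsubmxK (lsubmx y)).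
by move: ea eb ec; rewrite /xa /xb /xc => -> -> ->.
Qed.

Lemma heis_mxM (R : realType) (n : nat) (x y : 'rV[R]_(n + n + 1)) :
  heis_mx (heis_mul x y) = heis_mx x *m heis_mx y.
Proof.
rewrite /heis_mx !mulmx_block mul_row_block !(mulmx1, mul1mx, mulmx0, mul0mx).
rewrite !(addr0, add0r) /xa /xb /xc /heis_mul !(row_mxKl, row_mxKr).
rewrite add_row_mx linearD /= (addrC (lsubmx (lsubmx x))).
by rewrite (addrC (rsubmx (lsubmx x))^T) (addrC (rsubmx x)) addrAC -addrA addrCA
  addrA.
Qed.

Definition left_invariant (R : realType) (n : nat)
    (g : tensor2 R (n + n + 1)) : Prop :=
  forall a x, pullback (heis_mul a) g x = g x.

(* Row I of [coframe x] lists the components of theta^I at [x] with respect to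
   dx^1, ..., dx^N. *)
Definition coframe (R : realType) (n : nat) (x : 'rV[R]_(n + n + 1)) :
    'M[R]_(n + n + 1) :=
  block_mx 1%:M 0 (row_mx 0 (- xa x)) 1%:M.

(* sum_(I, J) G_IJ theta^I (x) theta^J *)
Definition coframe_tensor (R : realType) (n : nat) (G : 'M[R]_(n + n + 1)) :
    tensor2 R (n + n + 1) :=
  fun x => (coframe x)^T *m G *m coframe x.

(* sum_I d_I theta^I (x) theta^I *)
Definition diag_tensor (R : realType) (n : nat) (d : 'I_(n + n + 1) -> R) :
    tensor2 R (n + n + 1) :=
  coframe_tensor (diag_mx (\row_I d I)).

(* Convergence, as s tends to +oo, of the coefficients in the coframe. *)
Definition coframe_cvg (R : realType) (n : nat)
    (g : R -> tensor2 R (n + n + 1)) (h : tensor2 R (n + n + 1)) : Prop :=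
  exists (G : R -> 'M[R]_(n + n + 1)) (H : 'M[R]_(n + n + 1)),
    [/\ forall s, 0 < s -> forall x, g s x = coframe_tensor (G s) x,
        forall x, h x = coframe_tensor H x
      & forall I J, G s I J @[s --> +oo] --> H I J].

Definition soliton_solution (R : realType) (m : nat) (c : R -> R)
    (eta : R -> 'rV[R]_m -> 'rV[R]_m) (g : tensor2 R m) : R -> tensor2 R m :=
  fun t x => c t *: pullback (eta t) g x.

Definition nilsoliton (R : realType) (n : nat)
    (eta : R -> 'rV[R]_(n + n + 1) -> 'rV[R]_(n + n + 1))
    (g : tensor2 R (n + n + 1)) : Prop :=
  [/\ riemannian_metric g, left_invariant g,
      forall t, 0 < t -> diffeomorphism (eta t)
    & exists c : R -> R, ricci_flow `]0, +oo[ (soliton_solution c eta g)].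

Definition dilation (R : realType) (m : nat) (w : 'I_m -> R)
    (x : 'rV[R]_m) : 'rV[R]_m :=
  \row_I (w I * x 0 I).

(* The function on indices with the given values on 1..n, n+1..2n and N. *)
Definition by_block (R : realType) (n : nat) (u v : 'I_n -> R) (w : R)
    (I : 'I_(n + n + 1)) : R :=
  match fintype.split I with
  | inl K => match fintype.split K with inl i => u i | inr i => v i end
  | inr _ => w
  end.

Definition coefA (R : realType) (n : nat) (d : 'I_(n + n + 1) -> R) (i : 'I_n) : R :=
  d (ia i) / d (ib i).
(* [coefB d i] is B_(i+n). *)
Definition coefB (R : realType) (n : nat) (d : 'I_(n + n + 1) -> R) (i : 'I_n) : R :=
  d (ib i) / d (ia i).
Definition coefC (R : realType) (n : nat) (d : 'I_(n + n + 1) -> R) : R :=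
  (\prod_(K < n + n) d (lshift 1 K)) * d (iN n) ^+ 2.

(* The factors alpha^I(s), for the initial coefficients [d]. *)
Definition heis_alpha (R : realType) (n : nat) (d : 'I_(n + n + 1) -> R) (s : R) :
    'I_(n + n + 1) -> R :=
  by_block
    (fun i => n.+2%:R `^ (- (1 / (2 * n.+2%:R))) * coefA d i `^ (- (1 / 4))
      * coefC d `^ (- (1 / (4 * n.+2%:R))) * s `^ (n.+1%:R / (2 * n.+2%:R)))
    (fun i => n.+2%:R `^ (- (1 / (2 * n.+2%:R))) * coefB d i `^ (- (1 / 4))
      * coefC d `^ (- (1 / (4 * n.+2%:R))) * s `^ (n.+1%:R / (2 * n.+2%:R)))
    (n.+2%:R `^ (- (1 / n.+2%:R)) * coefC d `^ (- (1 / (2 * n.+2%:R)))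
      * s `^ (n.+1%:R / n.+2%:R)).

Definition heis_phi (R : realType) (n : nat) (d : 'I_(n + n + 1) -> R) (s : R) :
    'rV[R]_(n + n + 1) -> 'rV[R]_(n + n + 1) :=
  dilation (heis_alpha d s).

Definition heis_eta (R : realType) (n : nat) (t : R) :
    'rV[R]_(n + n + 1) -> 'rV[R]_(n + n + 1) :=
  dilation (by_block (fun=> t `^ (- (1 / 2) * (n.+1%:R / n.+2%:R)))
                     (fun=> t `^ (- (1 / 2) * (n.+1%:R / n.+2%:R)))
                     (t `^ (- (n.+1%:R / n.+2%:R)))).

Definition g_infty (R : realType) (n : nat) (t : R) : tensor2 R (n + n + 1) :=
  diag_tensor (by_block (fun=> t `^ (1 / n.+2%:R)) (fun=> t `^ (1 / n.+2%:R))
                        (1 / n.+2%:R * t `^ (- (n%:R / n.+2%:R)))).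

Arguments heis_eta {R} n t x.
Arguments g_infty {R} n t x.

(* Main.v *)
Require Import Defs.
From HB Require Import structures.
From mathcomp Require Import all_boot all_order all_algebra.
From mathcomp Require Import all_classical all_reals all_analysis.
From mathcomp Require Import ring.

Set Implicit Arguments.
Unset Strict Implicit.
Unset Printing Implicit Defensive.

Import Order.TTheory GRing.Theory Num.Theory.
Import numFieldNormedType.Exports.
Local Open Scope classical_set_scope.
Local Open Scope ring_scope.

(** Write u_i, v_i and w for the coefficients of theta^i, theta^(i+n) and
    theta^N, and eta for theta^N.  The metric is g = h + w eta (x) eta, with h
    a constant diagonal form in the other coordinates, and the
    partial derivatives of eta are constant.  With F the constant 2-form d eta
    and P_I^L its index raised by g, the Christoffel symbols are

      Gamma^L_IJ = delta_LN (partial_I eta_J + partial_J eta_I) / 2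
                   + w (eta_J P_I^L + eta_I P_J^L) / 2

    ([christoffelE]).  Since P is trace and divergence free, is annihilated by
    eta and has P_N = 0, contracting this expression leaves a diagonal Ricci tensor with
    constant coefficients ([ricci_diag_tensor]), and the Ricci flow becomes

      u_i' = w / v_i,   v_i' = w / u_i,   w' = - w^2 sum_i 1 / (u_i v_i)

    ([ricci_flow_diagP]).  Put p_i = u_i v_i.  Then u_i / v_i,
    C = w^2 prod_i p_i and the differences p_i - p_j are constant, while p_i' = 2 w.
    The quantity p_i / w has derivative 2 + sum_j p_i / p_j, which is at
    least 2; this and the conservation of C force p_i to infinity, hence
    p_i / p_j tends to 1 and the derivative to n + 2.  So p_i / (w t) tends to
    n + 2 and w^2 p_i^n to C, which determine the growth of p_i and w
    ([reduced_p_asymptotic], [reduced_w_asymptotic]).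

    Both phi_s and the soliton diffeomorphisms are dilations whose factor on
    x^N is the product of the factors on x^i and x^(i+n), so they rescale the coframe and
    multiply each coefficient by the square of a factor
    ([pullback_dilation]).  The scaling limit then follows from the asymptotics,
    after raising the rescaled coefficients to the powers 2 (n + 2) and n + 2,
    which makes all exponents integral; and g_infinity is checked to solve the
    three equations above. *)

(** * Indices and the coframe *)

Variant index_spec (n : nat) : 'I_(n + n + 1) -> Type :=
| IndexA i : index_spec (ia i)
| IndexB i : index_spec (ib i)
| IndexN : index_spec (iN n).

Lemma indexP (n : nat) (I : 'I_(n + n + 1)) : index_spec I.
Proof.
rewrite -(splitK I); case: (fintype.split I) => [K|j] /=; last first.
  by rewrite (ord1 j); exact: IndexN.
rewrite -(splitK K); case: (fintype.split K) => i /=.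
- exact: (IndexA i).
- exact: (IndexB i).
Qed.

Lemma index_eqE (n : nat) :
  (forall i j : 'I_n, ((ia i == ia j) = (i == j)) * ((ib i == ib j) = (i == j)) *
    ((ia i == ib j) = false) * ((ib i == ia j) = false)) *
  (forall i : 'I_n, ((ia i == iN n) = false) * ((iN n == ia i) = false) *
    ((ib i == iN n) = false) * ((iN n == ib i) = false)) *
  ((iN n == iN n) = true).
Proof.
split; last exact: eqxx.
split=> [i j|i]; rewrite /ia /ib /iN.
  rewrite (inj_eq (@lshift_inj _ _)) (inj_eq (@lshift_inj _ _)).
  rewrite (inj_eq (@lshift_inj _ _)) (inj_eq (@rshift_inj _ _)).
  by rewrite !(inj_eq (@lshift_inj _ _)) eq_lrshift eq_rlshift.
by rewrite !eq_lrshift !eq_rlshift.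
Qed.

Lemma by_blockE (R : realType) (n : nat) (u v : 'I_n -> R) (w : R) :
  (forall i, by_block u v w (ia i) = u i) *
  (forall i, by_block u v w (ib i) = v i) *
  (by_block u v w (iN n) = w).
Proof.
rewrite /by_block /ia /ib /iN; split; last by rewrite (unsplitK (inr _)).
by split=> i; rewrite (unsplitK (inl _)) ?(unsplitK (inl _)) ?(unsplitK (inr _)).
Qed.

Lemma sum_index (V : nmodType) (n : nat) (F : 'I_(n + n + 1) -> V) :
  \sum_I F I = \sum_i F (ia i) + \sum_i F (ib i) + F (iN n).
Proof. by rewrite big_split_ord big_split_ord big_ord1. Qed.

Lemma sum_delta (R : pzRingType) (n : nat) (i : 'I_n) (F : 'I_n -> R) :
  \sum_k (k == i)%:R * F k = F i.
Proof.
rewrite (bigD1 i) //= eqxx mul1r big1 ?addr0 // => k /negPf ->.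
by rewrite mul0r.
Qed.

Lemma xaE (R : realType) (n : nat) (x : 'rV[R]_(n + n + 1)) i :
  xa x 0 i = x 0 (ia i).
Proof. by rewrite /xa !mxE. Qed.

Lemma xbE (R : realType) (n : nat) (x : 'rV[R]_(n + n + 1)) i :
  xb x 0 i = x 0 (ib i).
Proof. by rewrite /xb !mxE. Qed.

Lemma coframeE (R : realType) (n : nat) (x : 'rV[R]_(n + n + 1)) I J :
  coframe x I J =
  (I == J)%:R + (I == iN n)%:R * by_block (fun=> 0) (fun j => - x 0 (ia j)) 0 J.
Proof.
rewrite /coframe.
case: (indexP I) => [i|i|]; case: (indexP J) => [j|j|];
  rewrite !by_blockE ?index_eqE /= ?mulr0 ?mul0r ?mul1r ?addr0 ?add0r.
all: rewrite /ia /ib /iN ?block_mxEul ?block_mxEur ?block_mxEdl ?block_mxEdr.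
all: rewrite ?row_mxEl ?row_mxEr ?mxE //= ?(inj_eq (@lshift_inj _ _)) ?eq_lrshift ?eq_rlshift //.
all: by rewrite ?(inj_eq (@lshift_inj _ _)) ?(inj_eq (@rshift_inj _ _)).
Qed.

(** The coframe is the identity plus a square-zero matrix that is linear in x. *)
Lemma coframe_mul (R : realType) (n : nat) (x y : 'rV[R]_(n + n + 1)) :
  coframe x *m coframe y = coframe (x + y).
Proof.
rewrite /coframe mulmx_block !(mulmx1, mul1mx, mulmx0, mul0mx, addr0, add0r).
rewrite add_row_mx addr0 -opprD.
by congr (block_mx _ _ (row_mx _ (- _)) _); rewrite /xa !linearD.
Qed.

Lemma coframe0 (R : realType) (n : nat) : coframe (0 : 'rV[R]_(n + n + 1)) = 1%:M.
Proof.
by rewrite /coframe /xa !linear0 row_mx0 -scalar_mx_block.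
Qed.

Lemma coframe_unit (R : realType) (n : nat) (x : 'rV[R]_(n + n + 1)) :
  coframe x \in unitmx.
Proof. by rewrite unitmxE det_lblock !det1 mulr1 unitr1. Qed.

Lemma diag_tensor_sum (R : realType) (n : nat) (d : 'I_(n + n + 1) -> R) x I J :
  diag_tensor d x I J = \sum_K coframe x K I * coframe x K J * d K.
Proof.
rewrite /diag_tensor /coframe_tensor; move: (coframe x) => C.
by rewrite mul_mx_diag mxE; apply: eq_bigr => K _; rewrite !mxE mulrAC.
Qed.

(** * Partial derivatives of polynomial functions *)

Lemma is_derive_coord (R : realType) (m : nat) (x v : 'rV[R]_m) (k : 'I_m) :
  is_derive x v (fun y : 'rV[R]_m => y 0 k : R^o) (v 0 k).
Proof.
have did : derivable (id : 'rV[R]_m -> 'rV[R]_m) x v by exact: derivable_id.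
have := derive_mx did; rewrite derive_id => /matrixP/(_ 0 k).
rewrite mxE => ->; apply: derivableP.
exact: ((derivable_mxP _ _ _).1 did).
Qed.

Lemma is_derive_cstf (R : realType) (m : nat) (x v : 'rV[R]_m) (c : R) :
  is_derive x v ((fun=> c) : 'rV[R]_m -> R^o) 0.
Proof. exact: is_derive_cst. Qed.

Lemma is_derive_add (R : realType) (V : normedModType R) (x v : V)
    (f g : V -> R^o) (a b : R) :
  is_derive x v f a -> is_derive x v g b ->
  is_derive x v (fun y => f y + g y : R^o) (a + b).
Proof. exact: is_deriveD. Qed.

Lemma is_derive_mul (R : realType) (V : normedModType R) (x v : V)
    (f g : V -> R^o) (a b : R) :
  is_derive x v f a -> is_derive x v g b ->
  is_derive x v (fun y => f y * g y : R^o) (a * g x + f x * b).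
Proof.
move=> fa gb; apply: is_derive_eq (is_deriveM fa gb) _.
by rewrite addrC mulrC.
Qed.

(** Polynomial functions are closed under partial derivatives, so smoothness of
    all orders follows from continuity and a single induction. *)
Inductive polyfun (R : realType) (m : nat) : ('rV[R]_m -> R) -> Prop :=
| PolyCst c : polyfun (fun=> c)
| PolyCoord k : polyfun (fun x => x 0 k)
| PolyAdd f g : polyfun f -> polyfun g -> polyfun (fun x => f x + g x)
| PolyMul f g : polyfun f -> polyfun g -> polyfun (fun x => f x * g x).

Lemma polyfun_is_derive (R : realType) (m : nat) (f : 'rV[R]_m -> R) (k : 'I_m) :
  polyfun f ->
  exists2 df, polyfun df &
    forall x, is_derive x (delta_mx 0 k) (f : 'rV[R]_m -> R^o) (df x).
Proof.
elim=> [c|j|{}f g _ [df pf fd] _ [dg pg gd]|{}f g pf [df pdf fd] pg [dg pdg gd]].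
- by exists (fun=> 0) => [|x]; [exact: PolyCst | exact: is_derive_cstf].
- exists (fun=> (delta_mx 0 k : 'rV[R]_m) 0 j) => [|x]; first exact: PolyCst.
  exact: is_derive_coord.
- exists (fun x => df x + dg x) => [|x]; first exact: PolyAdd.
  exact: is_derive_add.
- exists (fun x => df x * g x + f x * dg x) => [|x].
    by apply: PolyAdd; exact: PolyMul.
  exact: is_derive_mul.
Qed.

Lemma polyfun_continuous (R : realType) (m : nat) (f : 'rV[R]_m -> R) :
  polyfun f -> continuous f.
Proof.
elim=> [c|j|{}f g _ fc _ gc|{}f g _ fc _ gc] x.
- exact: cst_continuous.
- exact: coord_continuous.
- by apply: continuousD; [exact: fc | exact: gc].
- by apply: continuousM; [exact: fc | exact: gc].
Qed.

Lemma polyfun_smooth (R : realType) (m : nat) (f : 'rV[R]_m -> R) :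
  polyfun f -> smooth f.
Proof.
move=> + k; elim: k f => [|k IH] f pf /=; split=> //; try exact: polyfun_continuous.
move=> i; have [df pdf fd] := polyfun_is_derive i pf.
split=> [x|]; first by have [] := fd x.
suff -> : partial i f = df by exact: IH.
by apply/funext => x; rewrite /partial; apply: derive_val.
Qed.

Lemma polyfun_derivable (R : realType) (m : nat) (f : 'rV[R]_m -> R) (k : 'I_m) x :
  polyfun f -> derivable (f : 'rV[R]_m -> R^o) x (delta_mx 0 k).
Proof. by move/(polyfun_is_derive k) => [df _ /(_ x)[]]. Qed.

(** * Christoffel symbols and Ricci tensor of a diagonal metric *)

Section Geometry.
Variables (R : realType) (n : nat).
Implicit Types (x : 'rV[R]_(n + n + 1)) (I J K L : 'I_(n + n + 1)).

(** The components of eta = theta^N. *)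
Definition contact x I : R := by_block (fun=> 0) (fun i => - x 0 (ia i)) 1 I.

(** The constant partial derivatives partial_K eta_I. *)
Definition dcontact K I : R :=
  by_block (fun k => by_block (fun=> 0) (fun i => - (k == i)%:R) 0 I) (fun=> 0) 0 K.

Lemma contactN x : contact x (iN n) = 1.
Proof. by rewrite /contact by_blockE. Qed.

Lemma dcontactN :
  (forall K, dcontact K (iN n) = 0) * (forall K, dcontact (iN n) K = 0).
Proof.
split=> K; rewrite /dcontact ?by_blockE //.
by case: (indexP K) => [k|k|]; rewrite !by_blockE.
Qed.

Lemma polyfun_contact I : polyfun (fun x => contact x I).
Proof.
rewrite /contact; case: (indexP I) => [i|i|].
- under eq_fun do rewrite by_blockE; exact: PolyCst.
- under eq_fun do rewrite by_blockE -mulN1r.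
  by apply: PolyMul; [exact: PolyCst | exact: PolyCoord].
- under eq_fun do rewrite by_blockE; exact: PolyCst.
Qed.

Lemma is_derive_contact x K I :
  is_derive x (delta_mx 0 K) (fun y => contact y I : R^o) (dcontact K I).
Proof.
rewrite /contact; case: (indexP I) => [i|i|].
- under eq_fun do rewrite by_blockE.
  suff -> : dcontact K (ia i) = 0 by exact: is_derive_cst.
  by rewrite /dcontact; case: (indexP K) => [k|k|]; rewrite !by_blockE.
- under eq_fun do rewrite by_blockE -mulN1r.
  apply: is_derive_eq (is_derive_mul (is_derive_cstf _ _ _) (is_derive_coord _ _ _)) _.
  rewrite mxE mul0r add0r mulN1r /= eq_sym /dcontact.
  by case: (indexP K) => [k|k|]; rewrite !by_blockE ?index_eqE ?oppr0 // eq_sym.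
- by under eq_fun do rewrite by_blockE; rewrite dcontactN; exact: is_derive_cst.
Qed.

(** Diagonal entries of the form h in g = h + w eta (x) eta. *)
Definition horiz (d : 'I_(n + n + 1) -> R) I :=
  by_block (fun i => d (ia i)) (fun i => d (ib i)) 0 I.

Lemma diag_tensorE (d : 'I_(n + n + 1) -> R) x I J :
  diag_tensor d x I J = (I == J)%:R * horiz d I + d (iN n) * (contact x I * contact x J).
Proof.
rewrite diag_tensor_sum sum_index.
under eq_bigr do rewrite !coframeE !index_eqE !mul0r !addr0.
under [X in _ + X + _]eq_bigr do rewrite !coframeE !index_eqE !mul0r !addr0.
rewrite !coframeE !index_eqE !mul1r /horiz /contact.
case: (indexP I) => [i|i|]; case: (indexP J) => [j|j|]; rewrite !by_blockE ?index_eqE.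
all: do ?[under eq_bigr do rewrite !index_eqE -mulrA].
all: do ?[under [X in _ + X + _]eq_bigr do rewrite !index_eqE -mulrA].
all: rewrite ?sum_delta ?[X in X + _ + _]big1 ?[X in _ + X + _]big1; try by move=> *; rewrite !(mulr0, mul0r).
all: rewrite /= ?mulr0n ?mulr1n; try ring.
Qed.

Variable (d : 'I_(n + n + 1) -> R).
Local Notation w := (d (iN n)).

(** The components F_IJ of d eta. *)
Definition curv I J : R := dcontact I J - dcontact J I.

(** P_I^L: the vector with lowered index F_I (see [lower_curv_up]).  Its component
    along x^N is chosen so that eta vanishes on it. *)
Definition curv_up x I L : R :=
  by_block
    (fun i => by_block (fun=> 0) (fun l => - ((l == i)%:R / d (ib i))) (- (x 0 (ia i) / d (ib i))) L)
    (fun i => by_block (fun l => (l == i)%:R / d (ia i)) (fun=> 0) 0 L)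
    0 I.

Definition Gamma L I J x : R :=
  2^-1 * ((L == iN n)%:R * (dcontact I J + dcontact J I))
  + 2^-1 * w * (contact x J * curv_up x I L + contact x I * curv_up x J L).

Lemma polyfun_curv_up I L : polyfun (fun x => curv_up x I L).
Proof.
rewrite /curv_up; case: (indexP I) => [i|i|]; case: (indexP L) => [l|l|];
 under eq_fun do rewrite !by_blockE; try exact: PolyCst.
under eq_fun do rewrite mulrC -mulNr.
by apply: PolyMul; [exact: PolyCst | exact: PolyCoord].
Qed.

Lemma polyfun_Gamma L I J : polyfun (Gamma L I J).
Proof.
by apply: PolyAdd; [exact: PolyCst | apply: PolyMul; [exact: PolyCst |
  apply: PolyAdd; apply: PolyMul; [exact: polyfun_contact | exact: polyfun_curv_up |
   exact: polyfun_contact | exact: polyfun_curv_up]]].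
Qed.

Lemma contact_curv_up x I : \sum_L contact x L * curv_up x I L = 0.
Proof.
rewrite sum_index /curv_up /contact.
case: (indexP I) => [i|i|].
- under eq_bigr do rewrite !by_blockE mul0r.
  under [X in _ + X + _]eq_bigr do rewrite !by_blockE mulrNN mulrCA.
  by rewrite !by_blockE sum_delta big1 //; ring.
- under eq_bigr do rewrite !by_blockE mul0r.
  under [X in _ + X + _]eq_bigr do rewrite !by_blockE mulr0.
  by rewrite !by_blockE !big1 //; ring.
- by rewrite !by_blockE !big1 ?mulr0 ?addr0 // => l _; rewrite !by_blockE mulr0.
Qed.

Lemma curv_up_trace x : \sum_L curv_up x L L = 0.
Proof.
by rewrite sum_index /curv_up !big1 ?by_blockE ?addr0 // => l _; rewrite !by_blockE.
Qed.

Lemma curv_upN x L : curv_up x (iN n) L = 0.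
Proof. by rewrite /curv_up by_blockE. Qed.

Hypothesis d0 : forall I, d I != 0.

Lemma diag_tensorN x K : diag_tensor d x K (iN n) = w * contact x K.
Proof.
rewrite diag_tensorE contactN mulr1; case: (indexP K) => [k|k|];
 rewrite !index_eqE ?mul0r ?add0r //.
by rewrite /horiz by_blockE mulr0 add0r.
Qed.

(** As eta vanishes on P_I, only the diagonal form h contributes. *)
Lemma lower_curv_up x K I :
  \sum_L diag_tensor d x K L * curv_up x I L = curv I K.
Proof.
have -> : \sum_L diag_tensor d x K L * curv_up x I L = horiz d K * curv_up x I K.
  under eq_bigr do rewrite diag_tensorE mulrDl -!mulrA.
  rewrite big_split /= -mulr_sumr -mulr_sumr contact_curv_up !mulr0 addr0.
  rewrite (bigD1 K) //= eqxx mul1r big1 ?addr0 // => L /negPf.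
  by rewrite eq_sym => ->; rewrite mul0r.
rewrite /curv /horiz /curv_up /dcontact.
case: (indexP K) => [k|k|]; case: (indexP I) => [i|i|]; rewrite !by_blockE;
 try by ring.
- by case: (eqVneq k i) => [->|_] /=; rewrite ?mulr1n ?mulr0n; [field | ring].
- rewrite [i == k]eq_sym.
  by case: (eqVneq k i) => [->|_] /=; rewrite ?mulr1n ?mulr0n; [field | ring].
Qed.

Lemma diag_tensor_unit x : diag_tensor d x \in unitmx.
Proof.
rewrite !unitmx_mul unitmx_tr coframe_unit andbT /= unitmxE det_diag unitfE.
by apply/prodf_neq0 => I _; rewrite mxE.
Qed.

Lemma is_derive_diag_tensor x K I J :
  is_derive x (delta_mx 0 K) (fun y => diag_tensor d y I J : R^o)
    (w * (dcontact K I * contact x J + contact x I * dcontact K J)).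
Proof.
under eq_fun do rewrite diag_tensorE.
apply: is_derive_eq (is_derive_add (is_derive_cstf _ _ _)
 (is_derive_mul (is_derive_cstf _ _ _)
 (is_derive_mul (is_derive_contact _ _ _) (is_derive_contact _ _ _)))) _.
by rewrite add0r mul0r add0r.
Qed.

(** As h is constant, only w eta (x) eta contributes: the lowered Christoffel symbol is
    w (eta_K S_IJ + eta_J F_IK + eta_I F_JK) / 2 with S_IJ = partial_I eta_J + partial_J eta_I.
    Raising K turns eta_K into the vector field of x^N (because g_KN = w eta_K)
    and F_IK into P_I. *)
Lemma christoffelE L I J : christoffel (diag_tensor d) L I J = Gamma L I J.
Proof.
apply/funext => x; rewrite /christoffel /partial.
under eq_bigr do rewrite !(@derive_val _ _ _ _ _ _ _ (is_derive_diag_tensor _ _ _ _)).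
pose G := \col_M Gamma M I J x.
(* Both sides are twice the lowered symbol. *)
have GE K : w * (dcontact I J * contact x K + contact x J * dcontact I K)
   + w * (dcontact J I * contact x K + contact x I * dcontact J K)
   - w * (dcontact K I * contact x J + contact x I * dcontact K J) = 2 * (diag_tensor d x *m G) K 0.
  have -> : (diag_tensor d x *m G) K 0 = \sum_M diag_tensor d x K M * Gamma M I J x.
    by rewrite [LHS]mxE; apply: eq_bigr => M _; congr (_ * _); rewrite mxE.
  rewrite /Gamma.
  transitivity (w * contact x K * (dcontact I J + dcontact J I) +
    w * (contact x J * curv I K + contact x I * curv J K)).
    by rewrite /curv; ring.
  rewrite -!(lower_curv_up x).
  under [in RHS]eq_bigr do rewrite mulrDr.
  rewrite big_split /= [RHS]mulrDr; congr (_ + _).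
    rewrite (bigD1 (iN n)) //= big1 => [|L' /negPf ->]; last by rewrite mul0r mulr0 mulr0.
    by rewrite eqxx mul1r diag_tensorN addr0; field.
  rewrite !mulr_sumr -big_split /= mulr_sumr; apply: eq_bigr => M _.
  by field.
under eq_bigr do rewrite GE mulrCA.
rewrite -mulr_sumr mulrA mulVf ?pnatr_eq0 // mul1r.
have -> : Gamma L I J x = (invmx (diag_tensor d x) *m (diag_tensor d x *m G)) L 0.
  by rewrite mulKmx ?diag_tensor_unit // mxE.
by rewrite [RHS]mxE.
Qed.

(** The Ricci tensor of a diagonal metric in the coframe. *)
Definition ricci_coef : 'I_(n + n + 1) -> R :=
  by_block (fun i => - (w / (2 * d (ib i)))) (fun i => - (w / (2 * d (ia i))))
    (w ^+ 2 / 2 * \sum_i (d (ia i) * d (ib i))^-1).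

Lemma Gamma_sym L I J x : Gamma L I J x = Gamma L J I x.
Proof. by rewrite /Gamma; ring. Qed.

(** The volume form is constant in these coordinates, so the traces vanish. *)
Lemma Gamma_trace I x : \sum_L Gamma L I L x = 0.
Proof.
rewrite /Gamma big_split /= -mulr_sumr (bigD1 (iN n)) //= !dcontactN.
rewrite big1 => [|L /negPf ->]; last by rewrite mul0r.
rewrite !addr0 !mulr0 add0r -mulr_sumr big_split /= contact_curv_up -mulr_sumr.
by rewrite curv_up_trace; ring.
Qed.

(** P is divergence free: only its component along x^N varies, and
    nothing depends on x^N. *)
Lemma is_derive_curv_up_diag x I L :
  is_derive x (delta_mx 0 L) (fun y => curv_up y I L : R^o) 0.
Proof.
rewrite /curv_up; case: (indexP I) => [i|i|]; case: (indexP L) => [l|l|];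
 under eq_fun do rewrite !by_blockE; try exact: is_derive_cst.
under eq_fun do rewrite -mulNr mulrC -mulrN1.
apply: is_derive_eq (is_derive_mul (is_derive_cstf _ _ _)
 (is_derive_mul (is_derive_coord _ _ _) (is_derive_cstf _ _ _))) _.
by rewrite mxE index_eqE andbF !(mul0r, mulr0, addr0).
Qed.

(** The square of P has the two entries - 1 / (u_i v_i) on the diagonal for each i. *)
Lemma curv_up_square x :
  \sum_K \sum_L curv_up x L K * curv_up x K L = - 2 * \sum_i (d (ia i) * d (ib i))^-1.
Proof.
have K0 (i k : 'I_n) (a b : R) : (i == k)%:R * a * ((k == i)%:R * b) = (k == i)%:R * (a * b).
  by rewrite [i == k]eq_sym; case: eqP => _ /=; rewrite ?mulr1n ?mulr0n; ring.
have Ea (i : 'I_n) : \sum_L curv_up x L (ia i) * curv_up x (ia i) L = - (d (ia i) * d (ib i))^-1.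
  rewrite sum_index /curv_up !by_blockE mul0r addr0 big1 => [|k _]; last by rewrite !by_blockE mul0r.
  under eq_bigr do rewrite !by_blockE mulrN K0.
  by rewrite sumrN sum_delta add0r invfM.
have Eb (i : 'I_n) : \sum_L curv_up x L (ib i) * curv_up x (ib i) L = - (d (ia i) * d (ib i))^-1.
  rewrite sum_index /curv_up !by_blockE mul0r addr0 [X in _ + X]big1 => [|k _]; last by rewrite !by_blockE mul0r.
  under eq_bigr do rewrite !by_blockE mulNr K0.
  by rewrite sumrN sum_delta addr0 invfM mulrC.
rewrite sum_index [X in _ + X]big1 => [|L _]; last by rewrite curv_upN mulr0.
under eq_bigr do rewrite Ea.
under [X in _ + X + _]eq_bigr do rewrite Eb.
by rewrite addr0 sumrN; ring.
Qed.

Lemma curv_curv_up x I J :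
  w * \sum_L curv L I * curv_up x J L = 2 * ((I == J)%:R * horiz ricci_coef I).
Proof.
rewrite /horiz /ricci_coef sum_index /curv /curv_up /dcontact.
case: (indexP I) => [i|i|]; case: (indexP J) => [j|j|]; rewrite ?by_blockE ?index_eqE.
all: under eq_bigr do rewrite !by_blockE ?subrr ?mul0r ?mulr0.
all: under [X in _ + X + _]eq_bigr do rewrite !by_blockE ?subrr ?mul0r ?mulr0.
all: rewrite ?big1_eq /= ?mulr0n; try by ring.
- rewrite (eq_bigr (fun k => (k == j)%:R * ((i == k)%:R * - (d (ib j))^-1))); last by move=> *; ring.
  by rewrite sum_delta; case: eqVneq => [->|_] /=; rewrite ?mulr1n ?mulr0n; [field | ring].
- rewrite (eq_bigr (fun k => (k == j)%:R * ((k == i)%:R * - (d (ia j))^-1))); last by move=> *; ring.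
  rewrite sum_delta [j == i]eq_sym.
  by case: eqVneq => [->|_] /=; rewrite ?mulr1n ?mulr0n; [field | ring].
Qed.

Lemma is_derive_Gamma_diag x I J L :
  is_derive x (delta_mx 0 L) (Gamma L I J : 'rV[R]_(n + n + 1) -> R^o)
   (2^-1 * w * (dcontact L J * curv_up x I L + dcontact L I * curv_up x J L)).
Proof.
apply: is_derive_eq (is_derive_add (is_derive_cstf _ _ _)
 (is_derive_mul (is_derive_cstf _ _ _)
 (is_derive_add
  (is_derive_mul (is_derive_contact _ _ _) (is_derive_curv_up_diag _ _ _))
  (is_derive_mul (is_derive_contact _ _ _) (is_derive_curv_up_diag _ _ _))))) _.
by ring.
Qed.

Lemma partial_Gamma_trace x I J : \sum_L partial J (Gamma L I L) x = 0.
Proof.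
rewrite /partial -derive_sum => [|L]; last exact/polyfun_derivable/polyfun_Gamma.
rewrite (_ : \sum_i _ = cst 0) ?derive_cst //.
by apply/funext => y; rewrite fct_sumE Gamma_trace.
Qed.

(** Of the nine products of terms, those with a factor eta(P), P_N or S_IN vanish,
    where S_IJ = partial_I eta_J + partial_J eta_I.  What survives is S contracted with P, twice, and the trace of P^2. *)
Lemma Gamma_square x I J :
  \sum_K \sum_L Gamma K J L x * Gamma L I K x =
  4^-1 * w * (\sum_L (dcontact J L + dcontact L J) * curv_up x I L
             + \sum_L (dcontact I L + dcontact L I) * curv_up x J L)
  - 2^-1 * w ^+ 2 * (contact x I * contact x J) * \sum_i (d (ia i) * d (ib i))^-1.
Proof.
pose P := curv_up x.
have E K L : Gamma K J L x * Gamma L I K x =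
    (K == iN n)%:R * (2^-1 * (dcontact J L + dcontact L J) * Gamma L I K x)
  + (L == iN n)%:R *
      (4^-1 * w * (contact x L * P J K + contact x J * P L K) * (dcontact I K + dcontact K I))
  + (4^-1 * w ^+ 2 * (contact x K * P J K) * (contact x L * P I L)
   + 4^-1 * w ^+ 2 * contact x I * P J K * (contact x L * P K L)
   + 4^-1 * w ^+ 2 * contact x J * P I L * (contact x K * P L K)
   + 4^-1 * w ^+ 2 * (contact x I * contact x J) * (P L K * P K L)).
  by rewrite /Gamma /P; field.
under eq_bigr => K _ do under eq_bigr => L _ do rewrite E.
under eq_bigr => K _ do rewrite !big_split /=.
rewrite !big_split /=.
have -> : \sum_K \sum_L (K == iN n)%:R * (2^-1 * (dcontact J L + dcontact L J) * Gamma L I K x)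
   = 4^-1 * w * \sum_L (dcontact J L + dcontact L J) * P I L.
  under eq_bigr do rewrite -mulr_sumr.
  rewrite sum_delta mulr_sumr; apply: eq_bigr => L _.
  by rewrite /Gamma !dcontactN curv_upN contactN /P; field.
have -> : \sum_K \sum_L (L == iN n)%:R *
      (4^-1 * w * (contact x L * P J K + contact x J * P L K) * (dcontact I K + dcontact K I))
   = 4^-1 * w * \sum_L (dcontact I L + dcontact L I) * P J L.
  under eq_bigr do rewrite sum_delta.
  rewrite mulr_sumr; apply: eq_bigr => L _.
  by rewrite {2}/P curv_upN contactN; ring.
have -> : \sum_K \sum_L 4^-1 * w ^+ 2 * (contact x K * P J K) * (contact x L * P I L) = 0.
  by apply: big1 => K _; rewrite -mulr_sumr contact_curv_up mulr0.
have -> : \sum_K \sum_L 4^-1 * w ^+ 2 * contact x I * P J K * (contact x L * P K L) = 0.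
  by apply: big1 => K _; rewrite -mulr_sumr contact_curv_up mulr0.
have -> : \sum_K \sum_L 4^-1 * w ^+ 2 * contact x J * P I L * (contact x K * P L K) = 0.
  rewrite exchange_big /=.
  by apply: big1 => K _; rewrite -mulr_sumr contact_curv_up mulr0.
have -> : \sum_K \sum_L 4^-1 * w ^+ 2 * (contact x I * contact x J) * (P L K * P K L) =
   - 2^-1 * w ^+ 2 * (contact x I * contact x J) * \sum_i (d (ia i) * d (ib i))^-1.
  under eq_bigr do rewrite -mulr_sumr.
  by rewrite -mulr_sumr curv_up_square; field.
by rewrite /P; ring.
Qed.

(** The divergence of Gamma and the S-terms of [Gamma_square] combine into F contracted
    with P, the horizontal part; the trace of P^2 gives the part along eta. *)
Lemma ricci_diag_tensor x : ricci (diag_tensor d) x = diag_tensor ricci_coef x.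
Proof.
apply/matrixP => I J; rewrite diag_tensorE [LHS]mxE.
have -> : \sum_K (partial K (christoffel (diag_tensor d) K I J) x
        - partial J (christoffel (diag_tensor d) K I K) x) =
    2^-1 * w * \sum_L (dcontact L J * curv_up x I L + dcontact L I * curv_up x J L).
  under eq_bigr => K _ do rewrite !christoffelE //.
  rewrite sumrB [X in _ - X](partial_Gamma_trace x I J) subr0 mulr_sumr.
  by apply: eq_bigr => L _; exact: (@derive_val _ _ _ _ _ _ _ (is_derive_Gamma_diag _ _ _ _)).
have -> : \sum_K \sum_L
     (christoffel (diag_tensor d) K K L x * christoffel (diag_tensor d) L I J x
       - christoffel (diag_tensor d) K J L x * christoffel (diag_tensor d) L I K x)
    = - \sum_K \sum_L Gamma K J L x * Gamma L I K x.
  under eq_bigr => K _ do (under eq_bigr => L _ do rewrite !christoffelE //).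
  under eq_bigr => K _ do rewrite sumrB.
  rewrite sumrB exchange_big /= big1 ?sub0r // => L _.
  rewrite -mulr_suml (eq_bigr (fun K => Gamma K L K x)) => [|K _].
    by rewrite Gamma_trace mul0r.
  exact: Gamma_sym.
rewrite Gamma_square.
have C1 := curv_curv_up x I J; have C2 := curv_curv_up x J I.
have -> : (I == J)%:R * horiz ricci_coef I =
    4^-1 * w * (\sum_L curv L I * curv_up x J L + \sum_L curv L J * curv_up x I L).
  rewrite mulrDr -!mulrA C1 C2 [J == I]eq_sym.
  by case: eqVneq => [->|_] /=; rewrite ?mulr1n ?mulr0n; field.
rewrite /ricci_coef by_blockE.
(* The eta-terms cancel; the other terms cancel for each L separately. *)
set SS := \sum_i (_)^-1.
apply/eqP; rewrite -subr_eq0; apply/eqP.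
transitivity (\sum_L (2^-1 * w * (dcontact L J * curv_up x I L + dcontact L I * curv_up x J L)
  - 4^-1 * w * ((dcontact J L + dcontact L J) * curv_up x I L + (dcontact I L + dcontact L I) * curv_up x J L)
  - 4^-1 * w * (curv L I * curv_up x J L + curv L J * curv_up x I L))).
  by rewrite !sumrB -!mulr_sumr !big_split /=; field.
by apply: big1 => L _; rewrite /curv; field.
Qed.
End Geometry.

(** * Pullbacks, left invariance and the reduction of the flow *)

Definition jacobian (R : realType) (m : nat) (phi : 'rV[R]_m -> 'rV[R]_m) x : 'M[R]_m :=
  \matrix_(k, i) partial i (fun y => phi y 0 k) x.

(** The hypothesis says that phi pulls the coframe back to a constant combination of
    itself. *)
Lemma pullback_coframe_tensor (R : realType) (n : nat)
    (phi : 'rV[R]_(n + n + 1) -> 'rV[R]_(n + n + 1)) (G D : 'M[R]_(n + n + 1)) x :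
  coframe (phi x) *m jacobian phi x = D *m coframe x ->
  pullback phi (coframe_tensor G) x = coframe_tensor (D^T *m G *m D) x.
Proof.
move=> E; rewrite [RHS]/coframe_tensor.
have -> : (coframe x)^T *m (D^T *m G *m D) *m coframe x =
  (D *m coframe x)^T *m G *m (D *m coframe x) by rewrite trmx_mul !mulmxA.
rewrite -E trmx_mul.
have -> : (jacobian phi x)^T *m (coframe (phi x))^T *m G *m (coframe (phi x) *m jacobian phi x)
  = (jacobian phi x)^T *m coframe_tensor G (phi x) *m jacobian phi x.
  by rewrite /coframe_tensor !mulmxA.
move: (coframe_tensor G) => g.
apply/matrixP => i j; rewrite !mxE exchange_big /=; apply: eq_bigr => l _.
by rewrite !mxE mulr_suml; apply: eq_bigr => k _; rewrite !mxE mulrAC.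
Qed.

Lemma partial_dilation (R : realType) (m : nat) (w : 'I_m -> R) (x : 'rV[R]_m) i k :
  partial i (fun y => dilation w y 0 k) x = w k * (k == i)%:R.
Proof.
rewrite /partial /dilation; under eq_fun do rewrite mxE.
rewrite (@derive_val _ _ _ _ _ _ _ (is_derive_mul (is_derive_cstf _ _ _) (is_derive_coord _ _ _))).
by rewrite mul0r add0r mxE eqxx.
Qed.

(** The condition on w makes the dilation an automorphism of the group, so that
    theta^N is scaled by w N. *)
Lemma pullback_dilation (R : realType) (n : nat) (w d : 'I_(n + n + 1) -> R) x :
  (forall i, w (iN n) = w (ia i) * w (ib i)) ->
  pullback (dilation w) (diag_tensor d) x = diag_tensor (fun I => w I ^+ 2 * d I) x.
Proof.
move=> wN; rewrite /diag_tensor (@pullback_coframe_tensor _ _ _ _ (diag_mx (\row_I w I))).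
  rewrite tr_diag_mx !mulmx_diag; congr (coframe_tensor (diag_mx _) x).
  by apply/rowP => I; rewrite !mxE; ring.
have -> : jacobian (dilation w) x = diag_mx (\row_I w I).
  by apply/matrixP => k i; rewrite !mxE partial_dilation mulr_natr.
apply/matrixP => I J; rewrite mul_mx_diag mul_diag_mx mxE [RHS]mxE !(mxE _ (fun _ J => w J)) !coframeE.
case: (indexP J) => [j|j|]; rewrite !by_blockE.
- by case: eqVneq => [->|_]; rewrite ?index_eqE /=; ring.
- case: eqVneq => [->|_]; rewrite ?index_eqE /=; first by ring.
  case: eqVneq => [->|_] /=; rewrite ?mulr0n ?mulr1n; last by ring.
  by rewrite mxE (wN j); ring.
- by case: eqVneq => [->|_]; rewrite ?index_eqE /=; ring.
Qed.

Lemma is_derive_bigsum (R : realType) (V : normedModType R) (m : nat) (x v : V)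
    (f : 'I_m -> V -> R^o) (df : 'I_m -> R) :
  (forall i, is_derive x v (f i) (df i)) ->
  is_derive x v (fun y => \sum_i f i y : R^o) (\sum_i df i).
Proof.
by move=> fd; have := @is_derive_sum R V R^o m f x v df fd; rewrite fct_sumE.
Qed.

Lemma heis_mulE (R : realType) (n : nat) (a x : 'rV[R]_(n + n + 1)) k :
  heis_mul a x 0 k = a 0 k + x 0 k + (k == iN n)%:R * \sum_j a 0 (ia j) * x 0 (ib j).
Proof.
rewrite /heis_mul; case: (indexP k) => [i|i|]; rewrite ?index_eqE.
- by rewrite /ia !row_mxEl mxE !xaE mul0r addr0.
- by rewrite /ib row_mxEl row_mxEr mxE !xbE mul0r addr0.
- rewrite /iN row_mxEr !mxE mul1r; congr (_ + _).
  by apply: eq_bigr => j _; rewrite [_^T _ _]mxE xaE xbE.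
Qed.

(** Left translations are affine; this is their constant linear part. *)
Lemma jacobian_heis_mul (R : realType) (n : nat) (a x : 'rV[R]_(n + n + 1)) :
  jacobian (heis_mul a) x = coframe (- a).
Proof.
apply/matrixP => k i; rewrite coframeE mxE /partial; under eq_fun do rewrite heis_mulE.
rewrite (@derive_val _ _ _ _ _ _ _ (is_derive_add
  (is_derive_add (is_derive_cstf _ _ _) (is_derive_coord _ _ _))
  (is_derive_mul (is_derive_cstf _ _ _)
   (is_derive_bigsum (fun j => is_derive_mul (is_derive_cstf _ _ _) (is_derive_coord _ _ _)))))).
rewrite add0r mxE eqxx /=; congr (_ + _); rewrite mul0r add0r; congr (_ * _).
under eq_bigr do rewrite mul0r add0r mxE eqxx mulrC /=.
case: (indexP i) => [j|j|]; rewrite by_blockE ?mxE ?opprK.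
- by apply: big1 => l _; rewrite index_eqE mul0r.
- by under eq_bigr do rewrite index_eqE; rewrite sum_delta.
- by apply: big1 => l _; rewrite index_eqE mul0r.
Qed.

Lemma left_invariant_diag_tensor (R : realType) (n : nat) (d : 'I_(n + n + 1) -> R) :
  left_invariant (diag_tensor d).
Proof.
move=> a x; rewrite /diag_tensor (@pullback_coframe_tensor _ _ _ _ 1%:M).
  by rewrite trmx1 mulmx1 mul1mx.
rewrite jacobian_heis_mul coframe_mul mul1mx /coframe; congr (block_mx _ _ (row_mx _ (- _)) _).
by rewrite /xa !(linearD, linearN) /= !row_mxKl addrC addKr.
Qed.

Lemma diffeomorphism_dilation (R : realType) (m : nat) (w : 'I_m -> R) :
  (forall I, w I != 0) -> diffeomorphism (dilation w).
Proof.
move=> w0.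
have sm u : smooth_map (dilation u).
  move=> k; apply: polyfun_smooth; rewrite /dilation; under eq_fun do rewrite mxE.
  by apply: PolyMul; [exact: PolyCst | exact: PolyCoord].
split; first exact: sm.
by exists (dilation (fun I => (w I)^-1)); split=> // x; apply/rowP => I; rewrite !mxE ?mulKf ?mulVKf.
Qed.

(** In the coframe the quadratic form is sum_I d_I y_I^2, with y obtained from v
    by an invertible matrix. *)
Lemma diag_tensor_metricP (R : realType) (n : nat) (d : 'I_(n + n + 1) -> R) :
  riemannian_metric (diag_tensor d) <-> forall I, 0 < d I.
Proof.
have quad x (v : 'rV[R]_(n + n + 1)) : (v *m diag_tensor d x *m v^T) 0 0 =
    \sum_I d I * ((v *m (coframe x)^T) 0 I) ^+ 2.
  rewrite /diag_tensor /coframe_tensor.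
  have -> : v *m ((coframe x)^T *m diag_mx (\row_I d I) *m coframe x) *m v^T =
    (v *m (coframe x)^T) *m diag_mx (\row_I d I) *m (v *m (coframe x)^T)^T.
    by rewrite trmx_mul trmxK !mulmxA.
  move: (v *m _) => u; rewrite mul_mx_diag mxE; apply: eq_bigr => I _.
  by rewrite !mxE; ring.
split=> [[_ _ pos] I|d0].
  have /(pos 0) : (delta_mx 0 I : 'rV[R]_(n + n + 1)) != 0.
    by apply/eqP => /rowP/(_ I)/eqP; rewrite !mxE !eqxx /= oner_eq0.
  rewrite quad coframe0 trmx1 mulmx1 (bigD1 I) //= big1 => [|J /negPf JI].
    by rewrite mxE !eqxx addr0 expr1n mulr1.
  by rewrite mxE JI andbF expr0n mulr0.
split=> [I J|x|x v v0].
- apply: polyfun_smooth; under eq_fun do rewrite diag_tensorE.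
  apply: PolyAdd; first exact: PolyCst.
  by apply: PolyMul; [exact: PolyCst | apply: PolyMul; exact: polyfun_contact].
- by rewrite /diag_tensor /coframe_tensor !trmx_mul trmxK tr_diag_mx mulmxA.
- rewrite quad lt_def sumr_ge0 ?andbT => [|I _]; last by rewrite mulr_ge0 ?sqr_ge0 // ltW.
  apply: contra v0 => /eqP s0.
  have u0 : v *m (coframe x)^T = 0.
    apply/rowP => I; rewrite [RHS]mxE; apply/eqP.
    have /psumr_eq0P H : forall J, true -> 0 <= d J * ((v *m (coframe x)^T) 0 J) ^+ 2.
      by move=> J _; rewrite mulr_ge0 ?sqr_ge0 // ltW.
    by have /eqP := H s0 I isT; rewrite mulf_eq0 gt_eqF //= sqrf_eq0.
  have tu : (coframe x)^T \in unitmx by rewrite unitmx_tr coframe_unit.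
  by rewrite -(mulmxK tu v) u0 mul0mx.
Qed.

(** Each component of the metric is a combination, with factors not depending on time,
    of the coefficients, and so is each component of the Ricci tensor; conversely the
    coefficients are the diagonal components at the origin. *)
Lemma ricci_flow_diagP (R : realType) (n : nat) (T : set R)
    (g : 'I_(n + n + 1) -> R -> R) :
  ricci_flow T (fun t => diag_tensor (fun I => g I t)) <->
  forall t, T t -> (forall I, 0 < g I t) /\
    forall I, (s - t)^-1 * (g I s - g I t) @[s --> within T t^']
      --> - 2 * ricci_coef (fun I => g I t) I.
Proof.
split=> H t Tt; have [H1 H2] := H t Tt.
  have g0 := (diag_tensor_metricP _).1 H1; split=> // I.
  have d0 x h : diag_tensor h (0 : 'rV[R]_(n + n + 1)) x x = h x.
    rewrite diag_tensor_sum coframe0 (bigD1 x) //= big1 => [|J /negPf Jx].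
      by rewrite !mxE eqxx addr0 !mul1r.
    by rewrite !mxE Jx !mul0r.
  have := H2 0 I I; rewrite ricci_diag_tensor => [|J]; last by rewrite gt_eqF.
  by rewrite !d0; under eq_fun do rewrite d0.
split=> [|x I J]; first exact/diag_tensor_metricP.
rewrite ricci_diag_tensor => [|K]; last by rewrite gt_eqF.
have -> : (fun s => (s - t)^-1 * (diag_tensor (g^~ s) x I J - diag_tensor (g^~ t) x I J)) =
  (fun s => \sum_K coframe x K I * coframe x K J * ((s - t)^-1 * (g K s - g K t))).
  apply/funext => s; rewrite !diag_tensor_sum -sumrB mulr_sumr; apply: eq_bigr => K _.
  by rewrite -mulrBr mulrCA.
have -> : - 2 * diag_tensor (ricci_coef (g^~ t)) x I J =
  \sum_K coframe x K I * coframe x K J * (- 2 * ricci_coef (g^~ t) K).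
  by rewrite diag_tensor_sum mulr_sumr; apply: eq_bigr => K _; rewrite mulrCA.
apply: (cvg_big (@add_continuous _)) => K _; apply: cvgMl_tmp; exact: H2.
Qed.

(** * Differentiable functions on a half-line *)

Lemma cvg_near_eq (R : realType) (T : Type) {F : set_system T} {FF : Filter F}
    (f g : T -> R) (l : R) :
  (\forall x \near F, f x = g x) -> f @ F --> l -> g @ F --> l.
Proof.
move=> E fl P Pl; have := fl P Pl; rewrite !nbhs_simpl.
by apply: filterS2 E => x /= <-.
Qed.

Lemma dnbhs_translate (R : realType) (a c : R) :
  x + c @[x --> a^'] --> (a + c)^'.
Proof.
move=> P; rewrite /dnbhs /within /= => Pc.
have : x + c @[x --> a] --> a + c by apply: cvgD; [exact: cvg_id | exact: cvg_cst].
move=> /(_ _ Pc); rewrite nbhs_simpl /=.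
apply: (@filterS _ (nbhs a)) => x /= Px xa; apply: Px.
by rewrite (inj_eq (addIr c)).
Qed.

Lemma is_derive_quotientP (R : realType) (f : R -> R) (t l : R) :
  is_derive t 1 f l <-> (s - t)^-1 * (f s - f t) @[s --> t^'] --> l.
Proof.
pose q h := h^-1 * (f (h + t) - f t); pose p s := (s - t)^-1 * (f s - f t).
have qE : (fun h => h^-1 *: ((f \o shift t) (h *: 1) - f t)) = q.
  by apply/funext => h; rewrite /= /q [h *: 1]mulr1.
rewrite -[X in X @ _]/p; split=> [[df dl]|pl].
  have ql : q @ 0^' --> l by rewrite -dl -qE.
  have -> : p = q \o (fun s => s - t) by apply/funext => s; rewrite /q /p /= subrK.
  by apply: cvg_comp ql; have := @dnbhs_translate R t (- t); rewrite subrr.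
have ql : q @ 0^' --> l.
  have -> : q = p \o (fun h => h + t) by apply/funext => h; rewrite /q /p /= addrK.
  by apply: cvg_comp pl; have := @dnbhs_translate R 0 t; rewrite add0r.
apply: DeriveDef; first by rewrite /derivable qE; apply/cvg_ex; exists l.
by rewrite /derive qE; apply/cvg_lim.
Qed.

Lemma within_itv_dnbhs (R : realType) (t : R) (T : set R) : nbhs t T ->
  within T t^' = t^'.
Proof.
move=> Tt; apply/seteqP; split=> P; last exact: cvg_within.
rewrite /within /dnbhs /= => H.
by apply: filterS2 Tt H => s Ts Ps st; exact: Ps.
Qed.

Lemma right_cont_of_quotient (R : realType) (f : R -> R) (t l : R) :
  (s - t)^-1 * (f s - f t) @[s --> t^'+] --> l -> f s @[s --> t^'+] --> f t.
Proof.
move=> ql.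
have st : s - t @[s --> t^'+] --> t - t.
  by apply: cvgB; [exact/cvg_at_right_filter/cvg_id | exact: cvg_cst].
have H : (s - t) * ((s - t)^-1 * (f s - f t)) + f t @[s --> t^'+] --> (t - t) * l + f t.
  apply: (@cvgD _ _ _ _ _ (fun s => (s - t) * ((s - t)^-1 * (f s - f t))) (fun=> f t)); last exact: cvg_cst.
  exact: (cvgM st ql).
rewrite subrr mul0r add0r in H.
apply: (cvg_near_eq _ H).
near=> s; rewrite /= mulrA mulfV ?mul1r ?subrK //.
by rewrite subr_eq0 gt_eqF.
Unshelve. all: by end_near. Qed.

(** Functions to which the mean value theorem applies on every [0, b].  Only
    continuity is kept at 0, where the flow has a one-sided derivative. *)
Definition half_line_diff (R : realType) (f df : R -> R) :=
  (forall t : R, 0 < t -> is_derive t 1 f (df t)) /\ f s @[s --> 0^'+] --> f 0.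

Lemma half_line_MVT (R : realType) (f df : R -> R) (a b : R) :
  half_line_diff f df -> 0 <= a -> a < b ->
  exists2 c, a < c < b & f b - f a = df c * (b - a).
Proof.
move=> [fd f0] a0 ab.
have [t|| c cab ->] := @MVT R f df a b ab; last by exists c => //; rewrite in_itv in cab.
  by rewrite in_itv => /andP[at_ _]; apply: fd; exact: le_lt_trans at_.
have : {within `[0, +oo[, continuous f}.
  apply/continuous_within_itvcyP; split=> // t; rewrite in_itv andbT => t0.
  by apply/differentiable_continuous/derivable1_diffP; have [] := fd t t0.
by apply: continuous_subspaceW => s /=; rewrite !in_itv /= andbT => /andP[/(le_trans a0)].
Qed.

Lemma half_line_const (R : realType) (f : R -> R) t :
  half_line_diff f (fun=> 0) -> 0 <= t -> f t = f 0.
Proof.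
move=> fd; rewrite le_eqVlt => /predU1P[<- //|t0].
have [c _] := half_line_MVT fd (lexx 0) t0.
by rewrite mul0r => /eqP; rewrite subr_eq0 => /eqP.
Qed.

Lemma half_line_cst (R : realType) (c : R) : half_line_diff (fun=> c) (fun=> 0).
Proof.
by split=> [t _|]; [exact: is_derive_cst | exact: cvg_cst].
Qed.

Lemma half_lineD (R : realType) (f g df dg : R -> R) :
  half_line_diff f df -> half_line_diff g dg ->
  half_line_diff (fun t => f t + g t) (fun t => df t + dg t).
Proof.
move=> [fd f0] [gd g0]; split=> [t t0|]; last exact: cvgD.
by have := fd t t0; have := gd t t0 => ? ?; exact: is_deriveD.
Qed.

Lemma half_lineM (R : realType) (f g df dg : R -> R) :
  half_line_diff f df -> half_line_diff g dg ->
  half_line_diff (fun t => f t * g t) (fun t => df t * g t + f t * dg t).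
Proof.
move=> [fd f0] [gd g0]; split=> [t t0|]; last exact: cvgM.
have := fd t t0; have := gd t t0 => ? ?; apply: is_derive_eq (is_deriveM _ _) _.
by rewrite addrC mulrC.
Qed.

Lemma half_lineV (R : realType) (f df : R -> R) :
  (forall t, 0 <= t -> f t != 0) -> half_line_diff f df ->
  half_line_diff (fun t => (f t)^-1) (fun t => - (df t / f t ^+ 2)).
Proof.
move=> fn [fd f0]; split=> [t t0|]; last by apply: cvgV => //; exact: fn.
have := fd t t0 => ?; apply: is_derive_eq (is_deriveV (fn t (ltW t0)) _) _.
by rewrite /= scaleNr mulrC.
Qed.

Lemma half_line_eq (R : realType) (f df dg : R -> R) :
  half_line_diff f df -> (forall t, 0 < t -> df t = dg t) -> half_line_diff f dg.
Proof. by move=> [fd f0] E; split=> // t t0; rewrite -E //; exact: fd. Qed.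

Lemma half_line_prod (R : realType) (m : nat) (p dp : 'I_m -> R -> R) :
  (forall i t, 0 <= t -> p i t != 0) -> (forall i, half_line_diff (p i) (dp i)) ->
  half_line_diff (fun t => \prod_i p i t)
    (fun t => (\prod_i p i t) * \sum_i dp i t / p i t).
Proof.
move=> pn pd; elim: (index_enum _) => [|i r IH].
  under eq_fun do rewrite big_nil.
  split=> [t _|]; last exact: cvg_cst.
  by apply: is_derive_eq (is_derive_cst _ _ _) _; rewrite !big_nil mulr0.
under eq_fun do rewrite big_cons.
apply: half_line_eq (half_lineM (pd i) IH) _ => t t0.
by rewrite !big_cons; field; exact: pn (ltW t0).
Qed.

(** By the mean value theorem on [a, t], with a so large that the derivative is within
    e / 2 of its limit after a; the constant f a - l a is absorbed by 1 / t. *)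
Lemma cvg_slope (R : realType) (f df : R -> R) (l : R) :
  half_line_diff f df -> df t @[t --> +oo] --> l -> f t / t @[t --> +oo] --> l.
Proof.
move=> fd dl; apply/cvgrPdist_le => e e0.
have e2 : 0 < e / 2 by rewrite divr_gt0.
have /cvgrPdist_le /(_ _ e2) [M [_ HM]] := dl.
pose a := Num.max M 0.
pose b := f a - l * a.
near=> t.
have t0 : 0 < t by near: t; exact: nbhs_pinfty_gt.
have at_ : a < t by near: t; apply: nbhs_pinfty_gt; exact: num_real.
have a0 : 0 <= a by rewrite /a le_max lexx orbT.
have [c /andP[ac ct] E] := half_line_MVT fd a0 at_.
have Mc : M < c by apply: le_lt_trans ac; rewrite /a le_max lexx.
have := HM c Mc; rewrite -[l - df c]opprB normrN => Hc.
have bt : `|b| / t <= e / 2.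
  by rewrite ler_pdivrMr // -ler_pdivrMl //.
rewrite distrC.
have -> : f t / t - l = b / t + (df c - l) * ((t - a) / t).
  have -> : f t = f a + df c * (t - a) by rewrite -E; ring.
  by rewrite /b; field; rewrite gt_eqF.
rewrite (le_trans (ler_normD _ _)) // [e in _ <= e]splitr lerD //.
  by rewrite normrM normfV (gtr0_norm t0).
rewrite normrM (ger0_norm (x := (t - a) / t)); last first.
  by rewrite divr_ge0 ?ltW // subr_gt0.
rewrite -[_ / 2]mulr1 ler_pM //; first by rewrite divr_ge0 ?ltW // subr_gt0.
by rewrite ler_pdivrMr // mul1r gerBl.
Unshelve. all: by end_near. Qed.

(** * Asymptotics of the reduced flow *)

(** The equations satisfied by p_i = u_i v_i and w form a closed system. *)
Section ReducedFlow.
Variables (R : realType) (n : nat) (p : 'I_n -> R -> R) (w : R -> R).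
Hypothesis p0 : forall i (t : R), 0 <= t -> 0 < p i t.
Hypothesis w0 : forall t : R, 0 <= t -> 0 < w t.
Hypothesis pd : forall i, half_line_diff (p i) (fun t => 2 * w t).
Hypothesis wd : half_line_diff w (fun t => - (w t ^+ 2 * \sum_i (p i t)^-1)).

Let C := w 0 ^+ 2 * \prod_i p i 0.

Lemma reduced_difference i j t : 0 <= t -> p i t = p j t + (p i 0 - p j 0).
Proof.
move=> t0.
have H : half_line_diff (fun t => p i t + -1 * p j t) (fun=> 0).
  apply: half_line_eq (half_lineD (pd i) (half_lineM (half_line_cst (-1)) (pd j))) _.
  by move=> s _ /=; ring.
have /= := half_line_const H t0.
by move/(congr1 (fun z => z + p j t)) => E; rewrite -[LHS](subrK (p j t)) -mulN1r E; ring.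
Qed.

(** The logarithmic derivatives of w^2 and of the product of the p_i are opposite. *)
Lemma reduced_conserved t : 0 <= t -> w t ^+ 2 * \prod_i p i t = C.
Proof.
move=> t0; rewrite /C.
have pn i s : 0 <= s -> p i s != 0 by move=> /(p0 i); exact: lt0r_neq0.
have H : half_line_diff (fun t => (w t * w t) * \prod_i p i t) (fun=> 0).
  apply: half_line_eq (half_lineM (half_lineM wd wd) (half_line_prod pn pd)) _.
  move=> s s0 /=; rewrite -mulr_sumr; ring.
by have /= := half_line_const H t0; rewrite -!expr2.
Qed.

Lemma reduced_C_gt0 : 0 < C.
Proof. by rewrite mulr_gt0 ?exprn_gt0 ?w0 // prodr_gt0 // => i _; exact: p0. Qed.

Lemma reduced_quotient_diff i :
  half_line_diff (fun t => p i t / w t) (fun t => 2 + \sum_j p i t / p j t).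
Proof.
have wn s : 0 <= s -> w s != 0 by move=> /w0; exact: lt0r_neq0.
apply: half_line_eq (half_lineM (pd i) (half_lineV wn wd)) _ => t t0.
by rewrite -mulr_sumr; field; exact: wn (ltW t0).
Qed.

Lemma reduced_quotient_ge i t : 0 <= t -> 2 * t <= p i t / w t.
Proof.
move=> t0; have Fge0 s : 0 <= s -> 0 <= p i s / w s.
  by move=> s0; rewrite divr_ge0 // ltW // ?p0 ?w0.
move: t0; rewrite le_eqVlt => /predU1P[<-|t0]; first by rewrite mulr0 Fge0.
have [c /andP[c0 ct]] := half_line_MVT (reduced_quotient_diff i) (lexx 0) t0.
rewrite subr0 => E; rewrite -[p i t / w t](subrK (p i 0 / w 0)) E.
rewrite -[leLHS]addr0 lerD ?Fge0 // ler_pM2r // lerDl sumr_ge0 // => j _.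
by rewrite divr_ge0 // ltW // p0 // ltW.
Qed.

(** If p_i <= M at time t, then every p_j is at most M plus a constant, so the
    product of the p_j is at most a constant B.  With p_i >= 2 t w this gives
    4 t^2 C = (2 t w)^2 prod_j p_j <= M^2 B, which fails for large t. *)
Lemma reduced_cvgy i : p i t @[t --> +oo] --> +oo.
Proof.
apply/cvgryPgt => M0; pose M := Num.max M0 0.
pose B := \prod_j (M + `|p j 0 - p i 0|).
near=> t.
have t1 : 1 <= t by near: t; apply: nbhs_pinfty_ge; exact: num_real.
have tB : M ^+ 2 * B / (4 * C) < t by near: t; apply: nbhs_pinfty_gt; exact: num_real.
have t0 : 0 <= t by exact: le_trans t1.
apply: (@le_lt_trans _ _ M); first by rewrite le_max lexx.
rewrite ltNge; apply/negP => pM.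
have M_ge0 : 0 <= M by rewrite le_max lexx orbT.
have le1 : 4 * C * t ^+ 2 <= M ^+ 2 * B.
  rewrite -(reduced_conserved t0).
  have -> : 4 * (w t ^+ 2 * \prod_j p j t) * t ^+ 2 = (w t * (2 * t)) ^+ 2 * \prod_j p j t by ring.
  have wM : w t * (2 * t) <= M.
    rewrite mulrC -ler_pdivlMr ?w0 //.
    apply: le_trans (reduced_quotient_ge i t0) _.
    by rewrite ler_pM2r ?invr_gt0 ?w0.
  apply: ler_pM => //.
  - exact: sqr_ge0.
  - by apply: prodr_ge0 => j _; rewrite ltW ?p0.
  - by rewrite lerXn2r ?nnegrE // !mulr_ge0 // ltW ?w0.
  - apply: ler_prod => j _; rewrite ltW ?p0 //= (reduced_difference j i t0).
    by rewrite lerD // ler_norm.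
have C4 : 0 < 4 * C by apply: mulr_gt0 => //; exact: reduced_C_gt0.
have : M ^+ 2 * B < 4 * C * t ^+ 2.
  apply: (@lt_le_trans _ _ (4 * C * t)).
    by rewrite [ltRHS]mulrC -ltr_pdivrMr.
  by rewrite ler_pM2l // expr2 ler_peMr.
by rewrite ltNge le1.
Unshelve. all: by end_near. Qed.

Lemma reduced_ratio_cvg i j : p j t / p i t @[t --> +oo] --> (1 : R).
Proof.
have iV : (p i t)^-1 @[t --> +oo] --> (0 : R).
  apply/gtr0_cvgV0; last exact: reduced_cvgy.
  by near=> t; apply: p0; near: t; apply: nbhs_pinfty_ge; exact: num_real.
have H : 1 + (p j 0 - p i 0) * (p i t)^-1 @[t --> +oo] --> 1 + (p j 0 - p i 0) * 0.
  by apply: cvgD; [exact: cvg_cst | exact: cvgMl_tmp].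
rewrite mulr0 addr0 in H; apply: (cvg_near_eq _ H).
near=> t.
have t0 : 0 <= t by near: t; apply: nbhs_pinfty_ge; exact: num_real.
by rewrite (reduced_difference j i t0); field; rewrite gt_eqF ?p0.
Unshelve. all: by end_near. Qed.

(** The derivative 2 + sum_j p_i / p_j of p_i / w tends to 2 + n. *)
Lemma reduced_slope i : p i t / w t / t @[t --> +oo] --> (n.+2%:R : R).
Proof.
apply: cvg_slope (reduced_quotient_diff i) _.
have -> : n.+2%:R = 2 + \sum_(j < n) 1 :> R.
  by rewrite sumr_const card_ord -natrD.
apply: cvgD; first exact: cvg_cst.
by apply: (cvg_big (@add_continuous _)) => j _; exact: reduced_ratio_cvg.
Qed.

Lemma reduced_product_cvg i : w t ^+ 2 * p i t ^+ n @[t --> +oo] --> C.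
Proof.
have H : C * \prod_j (p i t / p j t) @[t --> +oo] --> C * \prod_(j < n) 1.
  apply: cvgMl_tmp; apply: (cvg_big (@mul_continuous _)) => j _; exact: reduced_ratio_cvg.
rewrite big1 // mulr1 in H; apply: (cvg_near_eq _ H).
near=> t.
have t0 : 0 <= t by near: t; apply: nbhs_pinfty_ge; exact: num_real.
rewrite -(reduced_conserved t0) -mulrA -big_split /=.
under eq_bigr => j _ do rewrite mulrC divfK ?gt_eqF ?p0 //.
by rewrite prodr_const card_ord.
Unshelve. all: by end_near. Qed.

Lemma cvgX (T : Type) {F : set_system T} {FF : Filter F} (f : T -> R) (l : R) (k : nat) :
  f @ F --> l -> f x ^+ k @[x --> F] --> l ^+ k.
Proof.
move=> fl; elim: k => [|k IH].
  by rewrite expr0; under eq_fun do rewrite expr0; exact: cvg_cst.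
by rewrite exprS; under eq_fun do rewrite exprS; exact: cvgM.
Qed.

(** p_i^(n+2) / t^2 is the product of (p_i / (w t))^2 and w^2 p_i^n. *)
Lemma reduced_p_asymptotic i :
  p i t ^+ n.+2 / t ^+ 2 @[t --> +oo] --> (n.+2%:R ^+ 2 * C : R).
Proof.
apply: cvg_near_eq (cvgM (cvgX (k := 2) (reduced_slope i)) (reduced_product_cvg i)).
near=> t.
have t0 : 0 < t by near: t; apply: nbhs_pinfty_gt; exact: num_real.
rewrite -[n.+2]addn2 exprD /=.
by field; rewrite !gt_eqF ?w0 ?ltW.
Unshelve. all: by end_near. Qed.

(** w^(n+2) t^n is the product of w^2 p_i^n and (w t / p_i)^n, for any index i. *)
Lemma reduced_w_asymptotic : (0 < n)%N ->
  w t ^+ n.+2 * t ^+ n @[t --> +oo] --> C / n.+2%:R ^+ n.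
Proof.
move=> n0; pose i := Ordinal n0.
have m0 : n.+2%:R != 0 :> R by rewrite pnatr_eq0.
rewrite -exprVn.
apply: cvg_near_eq (cvgM (reduced_product_cvg i) (cvgX (k := n) (cvgV m0 (reduced_slope i)))).
near=> t.
have t0 : 0 < t by near: t; apply: nbhs_pinfty_gt; exact: num_real.
have wn : w t != 0 by rewrite gt_eqF ?w0 ?ltW.
have pn : p i t != 0 by rewrite gt_eqF ?p0 ?ltW.
transitivity (w t ^+ 2 * p i t ^+ n * (w t * t / p i t) ^+ n).
  congr (_ * _ ^+ _); change ((p i t / w t / t)^-1 = w t * t / p i t).
  by field; rewrite pn wn gt_eqF.
rewrite -[n.+2]addn2 exprD !exprMn exprVn.
by field; rewrite expf_eq0 negb_and pn orbT.
Unshelve. all: by end_near. Qed.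

End ReducedFlow.

(** * Diagonal Ricci flow on the Heisenberg group *)

Lemma half_line_of_quotient (R : realType) (f df : R -> R) :
  (forall t, 0 <= t ->
    (s - t)^-1 * (f s - f t) @[s --> within `[0, +oo[ t^'] --> df t) ->
  half_line_diff f df.
Proof.
move=> H; split=> [t t0|].
  apply/is_derive_quotientP; have := H t (ltW t0).
  rewrite within_itv_dnbhs //; near=> s; rewrite /= in_itv /= andbT ltW //.
  by near: s; exact: lt_nbhsr.
apply: (@right_cont_of_quotient _ _ _ (df 0)).
move=> P /(H 0 (lexx 0)); rewrite !nbhs_simpl /at_right /dnbhs /within /=.
apply: (@filterS _ (nbhs (0 : R))) => s Ps s0; apply: Ps; rewrite ?gt_eqF //.
by rewrite in_itv /= andbT ltW.
Unshelve. all: by end_near. Qed.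

Section HeisenbergFlow.
Variables (R : realType) (n : nat) (g : 'I_(n + n + 1) -> R -> R).
Hypothesis hg : ricci_flow `[0, +oo[ (fun t => diag_tensor (fun I => g I t)).
Local Notation w := (g (iN n)).
Local Notation p i := (fun t => g (ia i) t * g (ib i) t).

Lemma flow_gt0 I t : 0 <= t -> 0 < g I t.
Proof.
move=> t0; have := (ricci_flow_diagP _ _).1 hg t; rewrite /= in_itv /= t0.
by case=> // + _; exact.
Qed.

Lemma flow_neq0 I t : 0 <= t -> g I t != 0.
Proof. by move=> t0; rewrite gt_eqF ?flow_gt0. Qed.

Lemma flow_diff I :
  half_line_diff (g I) (fun t => - 2 * ricci_coef (fun J => g J t) I).
Proof.
apply: half_line_of_quotient => t t0.
have := (ricci_flow_diagP _ _).1 hg t; rewrite /= in_itv /= t0.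
by case=> // _; exact.
Qed.

Lemma flow_diffA i : half_line_diff (g (ia i)) (fun t => w t / g (ib i) t).
Proof.
apply: half_line_eq (flow_diff _) _ => t t0; rewrite /ricci_coef by_blockE.
by field; rewrite flow_neq0 // ltW.
Qed.

Lemma flow_diffB i : half_line_diff (g (ib i)) (fun t => w t / g (ia i) t).
Proof.
apply: half_line_eq (flow_diff _) _ => t t0; rewrite /ricci_coef by_blockE.
by field; rewrite flow_neq0 // ltW.
Qed.

Lemma flow_diffN : half_line_diff w (fun t => - (w t ^+ 2 * \sum_i (p i t)^-1)).
Proof.
apply: half_line_eq (flow_diff _) _ => t t0; rewrite /ricci_coef by_blockE.
by field.
Qed.

Lemma flow_diff_prod i : half_line_diff (p i) (fun t => 2 * w t).
Proof.
apply: half_line_eq (half_lineM (flow_diffA i) (flow_diffB i)) _ => t t0.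
by field; rewrite !flow_neq0 // ltW.
Qed.

Lemma flow_ratio i t : 0 <= t -> g (ia i) t / g (ib i) t = g (ia i) 0 / g (ib i) 0.
Proof.
move=> t0.
have H : half_line_diff (fun t => g (ia i) t * (g (ib i) t)^-1) (fun=> 0).
  apply: half_line_eq (half_lineM (flow_diffA i) (half_lineV _ (flow_diffB i))) _ => s s0.
    exact: flow_neq0.
  by field; rewrite !flow_neq0 // ltW.
exact: (half_line_const H t0).
Qed.

Lemma coefC_initial : Defs.coefC (fun I => g I 0) = w 0 ^+ 2 * \prod_i p i 0.
Proof. by rewrite /Defs.coefC big_split_ord /= big_split /= mulrC. Qed.

Lemma flow_prod_gt0 i t : 0 <= t -> 0 < p i t.
Proof. by move=> t0; rewrite mulr_gt0 ?flow_gt0. Qed.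

Lemma coefC_gt0 : 0 < Defs.coefC (fun I => g I 0).
Proof.
rewrite coefC_initial mulr_gt0 ?exprn_gt0 ?flow_gt0 ?prodr_gt0 // => i _.
exact: flow_prod_gt0.
Qed.

Lemma flow_prod_asymptotic i :
  p i t ^+ n.+2 / t ^+ 2 @[t --> +oo] --> (n.+2%:R ^+ 2 * Defs.coefC (fun I => g I 0) : R).
Proof.
rewrite coefC_initial.
exact: (reduced_p_asymptotic (p := fun i => p i) flow_prod_gt0 (flow_gt0 _) flow_diff_prod flow_diffN).
Qed.

Lemma flow_N_asymptotic : (0 < n)%N ->
  w t ^+ n.+2 * t ^+ n @[t --> +oo] --> Defs.coefC (fun I => g I 0) / n.+2%:R ^+ n.
Proof.
rewrite coefC_initial.
exact: (reduced_w_asymptotic (p := fun i => p i) flow_prod_gt0 (flow_gt0 _) flow_diff_prod flow_diffN).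
Qed.
End HeisenbergFlow.

(** * The scaling limit *)

Lemma powRX (R : realType) (a x : R) k : (a `^ x) ^+ k = a `^ (x * k%:R).
Proof. by rewrite -powR_mulrn ?powR_ge0 // -powRrM. Qed.

Lemma cvg_powR (R : realType) (T : Type) {F : set_system T} {FF : Filter F}
    (f : T -> R) (l x : R) : 0 < l -> f @ F --> l -> f s `^ x @[s --> F] --> l `^ x.
Proof.
move=> l0 fl; have [D _] := is_derive1_powR x l0.
have c : {for l, continuous (fun y : R => y `^ x)} by apply/differentiable_continuous/derivable1_diffP.
exact: (cvg_comp _ (fun y : R => y `^ x) fl c).
Qed.

(** This reduces limits of quantities with fractional exponents to limits of integral
    powers. *)
Lemma cvg_of_power (R : realType) (T : Type) {F : set_system T} {FF : Filter F}
    (f : T -> R) (l : R) (k : nat) : (0 < k)%N -> 0 < l ->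
  (\forall s \near F, 0 < f s) -> f s ^+ k @[s --> F] --> l ->
  f @ F --> l `^ (k%:R^-1).
Proof.
move=> k0 l0 f0 fl; apply: cvg_near_eq (cvg_powR (x := k%:R^-1) l0 fl).
apply: filterS f0 => s fs.
by rewrite -powR_mulrn ?ltW // -powRrM mulfV ?pnatr_eq0 ?gtn_eqF // powRr1 // ltW.
Qed.

Lemma alpha_horizontal_power (R : realType) (n : nat) (A C s : R) :
  0 < A -> 0 < C -> 0 < s ->
  (n.+2%:R `^ (- (1 / (2 * n.+2%:R))) * A `^ (- (1 / 4))
      * C `^ (- (1 / (4 * n.+2%:R))) * s `^ (n.+1%:R / (2 * n.+2%:R))) ^+ (4 * n.+2)
  = (n.+2%:R ^+ 2)^-1 * (A ^+ n.+2)^-1 * C^-1 * s ^+ (2 * n.+1).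
Proof.
move=> A0 C0 s0; have m0 : n.+2%:R != 0 :> R by rewrite pnatr_eq0.
rewrite !exprMn !powRX natrM.
have -> : - (1 / (2 * n.+2%:R)) * (4%:R * n.+2%:R) = - 2%:R :> R by field.
have -> : - (1 / 4) * (4%:R * n.+2%:R) = - n.+2%:R :> R by field.
have -> : - (1 / (4 * n.+2%:R)) * (4%:R * n.+2%:R) = - 1 :> R by field.
have -> : n.+1%:R / (2 * n.+2%:R) * (4%:R * n.+2%:R) = (2 * n.+1)%:R :> R.
  by rewrite natrM; field.
by rewrite !powRN !powR_mulrn ?powRr1 ?ltW.
Qed.

Lemma alpha_vertical_power (R : realType) (n : nat) (C s : R) : 0 < C -> 0 < s ->
  (n.+2%:R `^ (- (1 / n.+2%:R)) * C `^ (- (1 / (2 * n.+2%:R)))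
      * s `^ (n.+1%:R / n.+2%:R)) ^+ (2 * n.+2)
  = (n.+2%:R ^+ 2)^-1 * C^-1 * s ^+ (2 * n.+1).
Proof.
move=> C0 s0; have m0 : n.+2%:R != 0 :> R by rewrite pnatr_eq0.
rewrite !exprMn !powRX natrM.
have -> : - (1 / n.+2%:R) * (2%:R * n.+2%:R) = - 2%:R :> R by field.
have -> : - (1 / (2 * n.+2%:R)) * (2%:R * n.+2%:R) = - 1 :> R by field.
have -> : n.+1%:R / n.+2%:R * (2%:R * n.+2%:R) = (2 * n.+1)%:R :> R.
  by rewrite natrM; field.
by rewrite !powRN !powR_mulrn ?powRr1 ?ltW.
Qed.

Lemma cvg_dilate_pinfty (R : realType) (f : R -> R) (l t : R) : 0 < t ->
  f s @[s --> +oo] --> l -> f (s * t) @[s --> +oo] --> l.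
Proof.
move=> t0; apply: cvg_comp; apply/cvgryPge => M; near=> s.
rewrite -ler_pdivrMr //; near: s; apply: nbhs_pinfty_ge; exact: num_real.
Unshelve. all: by end_near. Qed.

(** For u = u_i and A = u_i / v_i, or u = v_i and the inverse ratio, u^2 = A p_i; hence the
    power 2 (n + 2) of the rescaled coefficient is, up to a constant, p_i^(n+2) / s^2 at time s t. *)
Lemma horizontal_limit (R : realType) (n : nat) (u q : R -> R) (A C t : R) :
  0 < A -> 0 < C -> 0 < t -> (forall s, 0 < s -> 0 < u s) ->
  (forall s, 0 < s -> u s ^+ 2 = A * q s) ->
  q s ^+ n.+2 / s ^+ 2 @[s --> +oo] --> (n.+2%:R ^+ 2 * C : R) ->
  s^-1 * ((n.+2%:R `^ (- (1 / (2 * n.+2%:R))) * A `^ (- (1 / 4))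
      * C `^ (- (1 / (4 * n.+2%:R))) * s `^ (n.+1%:R / (2 * n.+2%:R))) ^+ 2
      * u (s * t)) @[s --> +oo] --> t `^ (1 / n.+2%:R).
Proof.
move=> A0 C0 t0 u0 uq /(cvg_dilate_pinfty t0) qC.
have m0 : 0 < n.+2%:R :> R by rewrite ltr0n.
have -> : t `^ (1 / n.+2%:R) = (t ^+ 2) `^ ((2 * n.+2)%:R^-1).
  rewrite -powR_mulrn ?ltW // -powRrM natrM; congr (_ `^ _).
  by field; rewrite gt_eqF.
apply: cvg_of_power => //; first by rewrite exprn_gt0.
  near=> s; have s0 : 0 < s by near: s; exact: nbhs_pinfty_gt.
  apply: mulr_gt0; first by rewrite invr_gt0.
  apply: mulr_gt0; last exact/u0/mulr_gt0.
  by apply: exprn_gt0; rewrite !mulr_gt0 ?powR_gt0.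
have H : t ^+ 2 / (n.+2%:R ^+ 2 * C) * (q (s * t) ^+ n.+2 / (s * t) ^+ 2) @[s --> +oo]
    --> t ^+ 2 / (n.+2%:R ^+ 2 * C) * (n.+2%:R ^+ 2 * C).
  exact: cvgMl_tmp qC.
rewrite divfK in H; last by rewrite mulf_neq0 ?expf_neq0 ?gt_eqF.
apply: (cvg_near_eq _ H); near=> s; have s0 : 0 < s by near: s; exact: nbhs_pinfty_gt.
rewrite [RHS]exprMn [(_ ^+ 2 * _) ^+ _]exprMn -exprM mulnA alpha_horizontal_power //.
rewrite [u _ ^+ _]exprM uq ?mulr_gt0 //.
rewrite !exprMn exprVn [(2 * n.+2)%N]mulnS exprD.
by field; rewrite !(expf_neq0, gt_eqF).
Unshelve. all: by end_near. Qed.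

(** The power n + 2 of the rescaled coefficient is, up to a constant, w^(n+2) s^n at
    time s t. *)
Lemma vertical_limit (R : realType) (n : nat) (w : R -> R) (C t : R) :
  0 < C -> 0 < t -> (forall s, 0 < s -> 0 < w s) ->
  w s ^+ n.+2 * s ^+ n @[s --> +oo] --> C / n.+2%:R ^+ n ->
  s^-1 * ((n.+2%:R `^ (- (1 / n.+2%:R)) * C `^ (- (1 / (2 * n.+2%:R)))
      * s `^ (n.+1%:R / n.+2%:R)) ^+ 2 * w (s * t)) @[s --> +oo]
    --> 1 / n.+2%:R * t `^ (- (n%:R / n.+2%:R)).
Proof.
move=> C0 t0 w0 /(cvg_dilate_pinfty t0) wC.
have m0 : 0 < n.+2%:R :> R by rewrite ltr0n.
have -> : 1 / n.+2%:R * t `^ (- (n%:R / n.+2%:R)) =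
    ((n.+2%:R ^+ n.+2)^-1 * (t ^+ n)^-1) `^ (n.+2%:R^-1).
  rewrite powRM ?invr_ge0 ?exprn_ge0 ?ltW // -!powR_mulrn ?ltW // -!powRN -!powRrM.
  by rewrite !mulNr mulfV ?gt_eqF // !powRN powRr1 ?ltW // div1r.
apply: cvg_of_power => //; first by rewrite mulr_gt0 ?invr_gt0 ?exprn_gt0.
  near=> s; have s0 : 0 < s by near: s; exact: nbhs_pinfty_gt.
  apply: mulr_gt0; first by rewrite invr_gt0.
  apply: mulr_gt0; last exact/w0/mulr_gt0.
  by apply: exprn_gt0; rewrite !mulr_gt0 ?powR_gt0.
have H : (n.+2%:R ^+ 2)^-1 * C^-1 * (t ^+ n)^-1 * (w (s * t) ^+ n.+2 * (s * t) ^+ n)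
    @[s --> +oo] --> (n.+2%:R ^+ 2)^-1 * C^-1 * (t ^+ n)^-1 * (C / n.+2%:R ^+ n).
  exact: cvgMl_tmp wC.
have E : (n.+2%:R ^+ 2)^-1 * C^-1 * (t ^+ n)^-1 * (C / n.+2%:R ^+ n) =
   (n.+2%:R ^+ n.+2)^-1 * (t ^+ n)^-1.
  rewrite [_ ^+ n.+2](exprD _ 2 n).
  by field; rewrite !(expf_neq0, gt_eqF).
rewrite {}E in H; apply: (cvg_near_eq _ H); near=> s; have s0 : 0 < s by near: s; exact: nbhs_pinfty_gt.
rewrite [RHS]exprMn [(_ ^+ 2 * _) ^+ _]exprMn -exprM alpha_vertical_power // exprVn.
have -> : s ^+ (2 * n.+1) = s ^+ n.+2 * s ^+ n.
  by rewrite -exprD; congr (_ ^+ _); rewrite mulSn mul1n addSnnS addnC addSnnS.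
by rewrite [(s * t) ^+ n]exprMn; field; rewrite !(expf_neq0, gt_eqF).
Unshelve. all: by end_near. Qed.

Lemma diag_tensorZ (R : realType) (n : nat) (c : R) (d : 'I_(n + n + 1) -> R) x :
  c *: diag_tensor d x = diag_tensor (fun I => c * d I) x.
Proof.
apply/matrixP => I J; rewrite [LHS]mxE !diag_tensor_sum mulr_sumr.
by apply: eq_bigr => K _; rewrite mulrCA.
Qed.

Lemma heis_alpha_gt0 (R : realType) (n : nat) (d : 'I_(n + n + 1) -> R) (s : R) I :
  (forall I, 0 < d I) -> 0 < s -> 0 < heis_alpha d s I.
Proof.
move=> d0 s0.
have C0 : 0 < Defs.coefC d by rewrite mulr_gt0 ?exprn_gt0 ?prodr_gt0.
by rewrite /heis_alpha; case: (indexP I) => [i|i|]; rewrite by_blockE !mulr_gt0 ?powR_gt0 ?divr_gt0.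
Qed.

Lemma heis_alphaN (R : realType) (n : nat) (d : 'I_(n + n + 1) -> R) (s : R) i :
  (forall I, 0 < d I) -> 0 < s ->
  heis_alpha d s (iN n) = heis_alpha d s (ia i) * heis_alpha d s (ib i).
Proof.
move=> d0 s0; rewrite /heis_alpha !by_blockE.
have C0 : 0 < Defs.coefC d by rewrite mulr_gt0 ?exprn_gt0 ?prodr_gt0.
have m0 : n.+2%:R != 0 :> R by rewrite pnatr_eq0.
have sq (a x : R) : 0 < a -> a `^ (x + x) = a `^ x * a `^ x.
  by move=> a0; rewrite powRD // (gt_eqF a0) implybT.
have AB : Defs.coefA d i `^ (- (1 / 4)) * Defs.coefB d i `^ (- (1 / 4)) = 1.
  rewrite -powRM ?divr_ge0 ?ltW // /Defs.coefA /Defs.coefB -invf_div mulVf ?powR1 //.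
  by rewrite mulf_neq0 ?invr_eq0 ?gt_eqF.
have -> : n.+2%:R `^ (- (1 / n.+2%:R)) =
    n.+2%:R `^ (- (1 / (2 * n.+2%:R))) * n.+2%:R `^ (- (1 / (2 * n.+2%:R))) :> R.
  by rewrite -sq ?ltr0n //; congr (_ `^ _); field.
have -> : Defs.coefC d `^ (- (1 / (2 * n.+2%:R))) =
    Defs.coefC d `^ (- (1 / (4 * n.+2%:R))) * Defs.coefC d `^ (- (1 / (4 * n.+2%:R))).
  by rewrite -sq //; congr (_ `^ _); field.
have -> : s `^ (n.+1%:R / n.+2%:R) =
    s `^ (n.+1%:R / (2 * n.+2%:R)) * s `^ (n.+1%:R / (2 * n.+2%:R)).
  by rewrite -sq //; congr (_ `^ _); field.
set X := n.+2%:R `^ _; set Y := Defs.coefC d `^ _; set Z := s `^ _.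
move: AB; set a := Defs.coefA d i `^ _; set b := Defs.coefB d i `^ _ => AB.
by transitivity (X * X * (a * b) * (Y * Y) * (Z * Z)); [rewrite AB; ring | ring].
Qed.

Lemma flow_scaling_limit (R : realType) (n : nat) (hn : (1 <= n)%N)
    (g : 'I_(n + n + 1) -> R -> R)
    (hg : ricci_flow `[0, +oo[ (fun t => diag_tensor (fun I => g I t))) (t : R) I :
  0 < t ->
  s^-1 * (heis_alpha (fun I => g I 0) s I ^+ 2 * g I (s * t)) @[s --> +oo] -->
  by_block (fun=> t `^ (1 / n.+2%:R)) (fun=> t `^ (1 / n.+2%:R))
                        (1 / n.+2%:R * t `^ (- (n%:R / n.+2%:R))) I.
Proof.
move=> t0; have C0 := coefC_gt0 hg.
have g0 J s : 0 < s -> 0 < g J s by move=> /ltW; exact: flow_gt0.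
have gg0 J : 0 < g J 0 by exact: flow_gt0.
rewrite /heis_alpha; case: (indexP I) => [i|i|]; under eq_fun do rewrite by_blockE; rewrite by_blockE.
- apply: (horizontal_limit _ C0 t0 (g0 (ia i)) _ (flow_prod_asymptotic hg i)).
    by rewrite divr_gt0.
  move=> s s0; rewrite /Defs.coefA -(flow_ratio hg i (ltW s0)).
  by field; rewrite gt_eqF ?g0.
- apply: (horizontal_limit _ C0 t0 (g0 (ib i)) _ (flow_prod_asymptotic hg i)).
    by rewrite divr_gt0.
  move=> s s0; rewrite /Defs.coefB -invf_div -(flow_ratio hg i (ltW s0)).
  by field; rewrite !gt_eqF ?g0.
- by apply: vertical_limit => //; [exact: g0 | exact: flow_N_asymptotic].
Qed.

Lemma ricci_flow_congr (R : realType) (m : nat) (T : set R) (f g : R -> tensor2 R m) :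
  (forall t, T t -> f t = g t) -> ricci_flow T f -> ricci_flow T g.
Proof.
move=> E H t Tt; have [H1 H2] := H t Tt; rewrite -E //; split=> // x i j.
apply: (cvg_near_eq _ (H2 x i j)).
by rewrite near_withinE; apply: nearW => s Ts; rewrite E.
Qed.

(** * The limit metric *)

Section Infinity.
Variables (R : realType) (n : nat).
Local Notation m := (n.+2%:R : R).
Let m0 : m != 0. Proof. by rewrite pnatr_eq0. Qed.
Let m2 : 2 + n%:R != 0 :> R. Proof. by rewrite -natrD; exact: m0. Qed.

(** All coefficients are multiples of powers of t, so each of the three equations is an
    identity between exponents and constant factors. *)
Lemma g_infty_flow : ricci_flow `]0, +oo[ (g_infty n : R -> _).
Proof.
pose g (I : 'I_(n + n + 1)) (t : R) :=
  by_block (fun=> t `^ (1 / n.+2%:R)) (fun=> t `^ (1 / n.+2%:R))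
    (1 / n.+2%:R * t `^ (- (n%:R / n.+2%:R))) I : R.
change (ricci_flow `]0, +oo[ (fun t => diag_tensor (fun I => g I t))).
apply/ricci_flow_diagP => t /=; rewrite in_itv /= andbT => t0.
have pD (x y : R) : t `^ (x + y) = t `^ x * t `^ y.
  by rewrite powRD // (gt_eqF t0) implybT.
split=> I.
  rewrite /g; case: (indexP I) => [i|i|]; rewrite by_blockE ?powR_gt0 //.
  by rewrite mulr_gt0 ?powR_gt0 ?divr_gt0.
rewrite within_itv_dnbhs; last first.
  by near=> s; rewrite /= in_itv /= andbT; near: s; exact: lt_nbhsr.
apply/is_derive_quotientP.
have horizontal : 1 / m * t `^ (1 / m - 1) =
    1 / m * t `^ (- (n%:R / m)) / t `^ (1 / m).
  rewrite -[RHS]mulrA -powRN -pD; congr (_ * _ `^ _).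
  by rewrite -[n.+2]addn2 natrD; field.
have D1 := is_derive1_powR (1 / m) t0.
have D2 := is_derive1_powR (- (n%:R / m)) t0.
rewrite /ricci_coef /g; case: (indexP I) => [i|i|].
- under eq_fun do rewrite by_blockE.
  apply: is_derive_eq D1 _; rewrite !by_blockE horizontal.
  by field; rewrite m2 gt_eqF ?powR_gt0.
- under eq_fun do rewrite by_blockE.
  apply: is_derive_eq D1 _; rewrite !by_blockE horizontal.
  by field; rewrite m2 gt_eqF ?powR_gt0.
- under eq_fun do rewrite by_blockE.
  apply: is_derive_eq (is_derive_mul (is_derive_cst (1 / m : R) t 1) D2) _.
  rewrite !by_blockE mul0r add0r.
  under eq_bigr do rewrite !by_blockE.
  rewrite (_ : \sum_(i < n) _ = n%:R * (t `^ (1 / m) * t `^ (1 / m))^-1) /cst; last first.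
    by rewrite sumr_const card_ord mulr_natl.
  have -> : t `^ (- (n%:R / m) - 1) =
     (t `^ (- (n%:R / m))) ^+ 2 * (t `^ (1 / m) * t `^ (1 / m))^-1.
    rewrite expr2 -!pD -powRN -pD; congr (_ `^ _).
    by rewrite -[n.+2]addn2 natrD; field.
  by field; rewrite m2 gt_eqF ?powR_gt0.
Unshelve. all: by end_near. Qed.

Lemma g_infty_soliton (t : R) x : 0 < t ->
  g_infty n t x = soliton_solution id (heis_eta n) (g_infty n 1) t x.
Proof.
move=> t0; have pD (a b : R) : t `^ (a + b) = t `^ a * t `^ b.
  by rewrite powRD // (gt_eqF t0) implybT.
rewrite /soliton_solution /heis_eta /g_infty pullback_dilation => [|i].
  rewrite diag_tensorZ; congr (diag_tensor _ x); apply/funext => I.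
  rewrite -[X in X * (_ * _)]powRr1 ?ltW // expr2 !powR1.
  case: (indexP I) => [i|i|]; rewrite !by_blockE mulr1 -!pD.
  - by congr (_ `^ _); rewrite -[n.+2]addn2 -[n.+1]addn1 !natrD; field.
  - by congr (_ `^ _); rewrite -[n.+2]addn2 -[n.+1]addn1 !natrD; field.
  - rewrite mulrA -!pD mulrC; congr (_ `^ _ * _).
    by rewrite -[n.+2]addn2 -[n.+1]addn1 !natrD; field.
by rewrite !by_blockE -pD; congr (_ `^ _); field.
Qed.
End Infinity.

Theorem mainTheorem4 (R : realType) (n : nat) (hn : (1 <= n)%N)
    (g : 'I_(n + n + 1) -> R -> R)
    (hg : ricci_flow `[0, +oo[ (fun t => diag_tensor (fun I => g I t))) :
  let g0 := fun I => g I 0 in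
  [/\ forall s : R, 0 < s -> diffeomorphism (heis_phi g0 s),
      forall s : R, 0 < s -> forall i : 'I_n,
        heis_alpha g0 s (iN n) = heis_alpha g0 s (ia i) * heis_alpha g0 s (ib i),
      forall t : R, 0 < t ->
        coframe_cvg
          (fun s x => s^-1 *:
             pullback (heis_phi g0 s) (diag_tensor (fun I => g I (s * t))) x)
          (g_infty n t),
      nilsoliton (heis_eta n : R -> _) (g_infty n 1)
    & (forall t : R, 0 < t -> forall x,
         g_infty n t x = soliton_solution id (heis_eta n) (g_infty n 1) t x) /\
      ricci_flow `]0, +oo[ (g_infty n : R -> _)].
Proof.
move=> g0; have g0_gt0 I : 0 < g0 I by exact: (flow_gt0 hg).
split.
- move=> s s0; apply: diffeomorphism_dilation => I.
  by rewrite gt_eqF // heis_alpha_gt0.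
- by move=> s s0 i; exact: heis_alphaN.
- move=> t t0.
  exists (fun s => diag_mx (\row_I (s^-1 * (heis_alpha g0 s I ^+ 2 * g I (s * t))))).
  eexists; split=> [s s0 x||I J].
  + rewrite pullback_dilation => [|i]; first exact: diag_tensorZ.
    exact: heis_alphaN.
  + by move=> x; reflexivity.
  + rewrite mxE mxE; under eq_fun do rewrite mxE mxE.
    case: eqVneq => [->|_]; last by rewrite mulr0n; exact: cvg_cst.
    by rewrite mulr1n; exact: flow_scaling_limit.
- split.
  + apply/diag_tensor_metricP => I.
    by case: (indexP I) => [i|i|]; rewrite by_blockE !powR1 ?mulr1 ?divr_gt0.
  + exact: left_invariant_diag_tensor.
  + move=> t t0; apply: diffeomorphism_dilation => I.
    by case: (indexP I) => [i|i|]; rewrite by_blockE gt_eqF ?powR_gt0.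
  + exists id; apply: ricci_flow_congr (@g_infty_flow R n) => t /=.
    rewrite in_itv /= andbT => t0; apply/funext => x; exact: g_infty_soliton.
- by split=> [t t0 x|]; [exact: g_infty_soliton | exact: g_infty_flow].
Qed.
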